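(* The isomorphism problem is polynomial time decidable in $|\Sigma|,|\Gamma_1|,|\Gamma_2|$: there is an algorithm which, given a finite functional signature $\Sigma$ and two finite sets $\Gamma_1,\Gamma_2$ of ground term equations over $\Sigma$, decides in time polynomial in $|\Sigma|,|\Gamma_1|,|\Gamma_2|$ whether $\mathcal{F}_{\Gamma_1}\cong\mathcal{F}_{\Gamma_2}$.
   Context: $\Sigma$ is a finite functional signature having function symbols (of positive arity) and constant symbols. $\mathcal{F}$ is the algebra of all ground terms (terms without variables) over $\Sigma$, with operations interpreted by term formation. A ground term equation is an expression $p=q$ with $p,q$ ground terms. For a finite set $\Gamma$ of such equations, $\sim_\Gamma$ is the smallest congruence on $\mathcal{F}$ containing all pairs $(p,q)$ with $p=q$ in $\Gamma$ (equivalently, $p\sim_\Gamma q$ iff $\Gamma\vdash p=q$), and $\mathcal{F}_\Gamma=\mathcal{F}/{\sim_\Gamma}$. Isomorphism is isomorphism of $\Sigma$-structures (in particular it respects the constants). The size $|t|$ of a ground term is the number of nodes of its syntax tree, and $|\Gamma|=\sum_{(p=q)\in\Gamma}(|p|+|q|)$. *)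

(* Defs.v *)
From HB Require Import structures.
From mathcomp Require Import all_boot all_order all_algebra.
From mathcomp Require Import boolp.
Set Implicit Arguments.
Unset Strict Implicit.
Unset Printing Implicit Defensive.

(* Symbols are numbered; constants are the symbols of arity 0. *)
Record signature := Signature {
  nsym : nat;
  arity : 'I_nsym -> nat }.

Inductive term (S : signature) : Type :=
  App (f : 'I_(nsym S)) (a : {ffun 'I_(arity f) -> term S}).

(* Classical equality and choice, so that terms can be quotiented. *)
HB.instance Definition _ (S : signature) := gen_eqMixin (term S).
HB.instance Definition _ (S : signature) := gen_choiceMixin (term S).

Definition equation (S : signature) : Type := (term S * term S)%type.

Record structure (S : signature) := Structure {
  carrier :> Type;
  op : forall f : 'I_(nsym S), {ffun 'I_(arity f) -> carrier} -> carrier }.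

Definition free_algebra (S : signature) : structure S := Structure (@App S).

Definition is_hom (S : signature) (A B : structure S) (h : A -> B) : Prop :=
  forall (f : 'I_(nsym S)) (a : {ffun 'I_(arity f) -> A}),
    h (op a) = op [ffun i => h (a i)].

Definition isomorphic (S : signature) (A B : structure S) : Prop :=
  exists h : A -> B, bijective h /\ is_hom h.

Record congruence (S : signature) (A : structure S) (R : A -> A -> Prop) :
    Prop := Congruence {
  cong_refl : forall x, R x x;
  cong_sym : forall x y, R x y -> R y x;
  cong_trans : forall x y z, R x y -> R y z -> R x z;
  cong_op : forall (f : 'I_(nsym S)) (a b : {ffun 'I_(arity f) -> A}),
    (forall i, R (a i) (b i)) -> R (op a) (op b) }.

Definition sim (S : signature) (G : seq (equation S)) (p q : term S) : Prop :=
  forall R : term S -> term S -> Prop,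
    @congruence S (free_algebra S) R ->
    (forall e : equation S, e \in G -> R e.1 e.2) -> R p q.

Lemma sim_congruence (S : signature) (G : seq (equation S)) :
  @congruence S (free_algebra S) (sim G).
Proof.
split=> [x R cR _|x y xy R cR RG|x y z xy yz R cR RG|f a b ab R cR RG].
- exact: (cong_refl cR).
- by apply: (cong_sym cR); apply: xy.
- by apply: (cong_trans cR) (xy R cR RG) (yz R cR RG).
- by apply: (cong_op cR) => i; apply: ab.
Qed.

Definition simb (S : signature) (G : seq (equation S)) : rel (term S) :=
  fun p q => `[< sim G p q >].

Lemma simb_refl (S : signature) (G : seq (equation S)) : reflexive (simb G).
Proof. by move=> x; apply/asboolP; apply: (cong_refl (sim_congruence G)). Qed.

Lemma simb_sym (S : signature) (G : seq (equation S)) : symmetric (simb G).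
Proof.
by move=> x y; apply/asboolP/asboolP; apply: (cong_sym (sim_congruence G)).
Qed.

Lemma simb_trans (S : signature) (G : seq (equation S)) : transitive (simb G).
Proof.
move=> y x z /asboolP xy /asboolP yz; apply/asboolP.
exact: (cong_trans (sim_congruence G) xy yz).
Qed.

Canonical sim_equiv (S : signature) (G : seq (equation S)) :=
  EquivRel (simb G) (simb_refl G) (simb_sym G) (@simb_trans S G).

Definition classes (S : signature) (G : seq (equation S)) : Type :=
  {eq_quot (sim_equiv G)}%qT.

Definition class (S : signature) (G : seq (equation S)) (t : term S) :
  classes G := (\pi_({eq_quot (sim_equiv G)}) t)%qT.

Definition quotient (S : signature) (G : seq (equation S)) : structure S :=
  @Structure S (classes G)
    (fun f c => class G (App [ffun i => repr (c i : {eq_quot (sim_equiv G)}%qT)])).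

Lemma class_eq (S : signature) (G : seq (equation S)) (p q : term S) :
  class G p = class G q <-> sim G p q.
Proof.
split=> [pq|pq].
  by apply/asboolP; move/eqP: pq; rewrite /class eqmodE.
by apply/eqP; rewrite /class eqmodE; apply/asboolP.
Qed.

(* The operations of [quotient] do not depend on the representatives. *)
Lemma class_hom (S : signature) (G : seq (equation S)) :
  @is_hom S (free_algebra S) (quotient G) (class G).
Proof.
move=> f a /=; apply/class_eq; apply: (cong_op (sim_congruence G)) => i.
by rewrite !ffunE; apply/class_eq; rewrite /class reprK.
Qed.

Fixpoint term_size (S : signature) (t : term S) : nat :=
  let: App f a := t in (\sum_(i < arity f) term_size (a i)).+1.

Definition eqs_size (S : signature) (G : seq (equation S)) : nat :=
  \sum_(e <- G) (term_size e.1 + term_size e.2).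

Definition enc_nat (n : nat) : seq bool := rcons (nseq n true) false.

(* Each item is announced by [true], the end of the list by [false]. *)
Definition enc_seq (T : Type) (enc : T -> seq bool) (s : seq T) : seq bool :=
  rcons (flatten [seq true :: enc x | x <- s]) false.

Fixpoint enc_term (S : signature) (t : term S) : seq bool :=
  let: App f a := t in
  enc_nat f ++ enc_seq (fun i => enc_term (a i)) (enum 'I_(arity f)).

Definition enc_equation (S : signature) (e : equation S) : seq bool :=
  enc_term e.1 ++ enc_term e.2.

Definition enc_signature (S : signature) : seq bool :=
  enc_seq (fun f => enc_nat (arity f)) (enum 'I_(nsym S)).

(* The signature comes last because the time bound counts symbols only: the
   arities of symbols that do not occur in the equations are not bounded by
   the sizes of the instance, so a machine may not have the time to read them. *)
Definition enc_instance (S : signature) (G1 G2 : seq (equation S)) :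
    seq bool :=
  enc_seq (@enc_equation S) G1 ++ enc_seq (@enc_equation S) G2
    ++ enc_signature S.

Inductive move := MoveL | MoveR | Stay.

(* The tape symbols are the blank [None], the two input symbols and the working
   symbols.  There are [extra_tapes.+1] tapes, the input being on tape 0.
   A state with [verdict q = Some b] is halting, with answer [b]. *)
Record machine := Machine {
  extra_tapes : nat;
  work : finType;
  state : finType;
  start : state;
  verdict : state -> option bool;
  cell := option (bool + work)%type;
  trans : state -> {ffun 'I_extra_tapes.+1 -> cell} ->
          state * ('I_extra_tapes.+1 -> cell * move) }.

(* [tleft] is listed from the head leftwards, [tright] from the head rightwards;
   all cells beyond these lists are blank. *)
Record tape (C : Type) := Tape { tleft : seq C; thead : C; tright : seq C }.

Definition tape_of (C : Type) (s : seq (option C)) : tape (option C) :=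
  Tape [::] (head None s) (behead s).

Definition act (C : Type) (t : tape (option C)) (cm : option C * move) :
    tape (option C) :=
  let: Tape l _ r := t in
  let: (c, m) := cm in
  match m with
  | MoveL => Tape (behead l) (head None l) (c :: r)
  | MoveR => Tape (c :: l) (head None r) (behead r)
  | Stay => Tape l c r
  end.

Record config (M : machine) := Config {
  cstate : state M;
  ctapes : 'I_(extra_tapes M).+1 -> tape (cell M) }.

Definition step (M : machine) (c : config M) : config M :=
  if verdict (cstate c) is Some _ then c else
  let: (q, w) := trans (cstate c) [ffun i => thead (ctapes c i)] in
  Config q (fun i => act (ctapes c i) (w i)).

Definition init (M : machine) (x : seq bool) : config M :=
  Config (start M) (fun i =>
    tape_of (if i == ord0 then [seq Some (inl (work M) b) | b <- x] else [::])).

(* Halting configurations are fixed by [step], so this also covers the runs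
   that halt in fewer than [n] steps. *)
Definition answers_within (M : machine) (x : seq bool) (n : nat) (b : bool) :
    Prop :=
  verdict (cstate (iter n (@step M) (init M x))) = Some b.

Definition poly3_eval (P : {poly {poly {poly nat}}}) (x y z : nat) : nat :=
  (P.[x%:P%:P].[y%:P].[z])%R.

(* Main.v *)
Require Import Defs.
From mathcomp Require Import all_boot all_order all_algebra.
From HB Require Import structures.
From mathcomp Require Import boolp zify.
Import Defs.
Set Implicit Arguments.
Unset Strict Implicit.
Unset Printing Implicit Defensive.

(** Both quotients are generated by their constants, so an isomorphism can only
    send the class of a term to the class of the same term: the quotients are
    isomorphic iff each of the two sets of equations follows from the other.

    Since a ground congruence is determined on the subterms of the equations by
    finitely many Horn clauses, entailment becomes a fixed Datalog program over
    the positions of the input string: binary facts state where the terms end,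
    which positions carry congruent terms, and up to which equation everything
    has been derived.  A Turing machine evaluates such a program naively.  Its
    variables are the heads of tapes holding a copy of the string, the facts are
    kept on a tape with one cell per pair of positions, and the rules are fired
    for all values of the variables, as often as there can be facts.  All loops
    are bounded by the length of the string, hence the polynomial time. *)

(** * Programs for multi-tape machines *)

(** A derivation may pass through arbitrarily large terms. They prove nothing new about the terms in
    the input, because sending every term to a class of occurring terms, or to the empty set, is a
    homomorphism whose kernel contains the equations. Both congruences are computed over the whole
    string, since entailment asks about the terms of one list under the other theory. The signature
    lies beyond what may be read, so arities are unknown and the rules also fire at positions where
    no term starts; soundness rests on an interpretation that is vacuous there. Six variables are
    what the clause for argument lists takes. A pass over all their values either adds a fact or
    shows that none is missing, and the 24 codes of predicates allow at most [24 * N ^ 2] facts. Six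
    more loops give [N ^ 6] passes, enough as soon as [24 < N ^ 4]. The string has polynomial length
    because symbols are written in unary, each in at most $|\Sigma|$ bits. *)

Section Programs.
Variables (k : nat) (W : finType).
Local Notation cell := (option (bool + W)%type).
Local Notation tapes := ('I_k.+1 -> tape cell).
Local Notation reading := {ffun 'I_k.+1 -> cell}.
Local Notation writing := ('I_k.+1 -> cell * move).

(** A transition without a next state ends the program after its writes; the combinators below
    redirect it. *)
Record prog := Prog {
  pstate : finType;
  pentry : pstate;
  ptrans : pstate -> reading -> option pstate * writing }.

Definition heads (ts : tapes) : reading := [ffun i => thead (ts i)].
Definition acts (ts : tapes) (w : writing) : tapes := fun i => act (ts i) (w i).
Definition idle (h : reading) : writing := fun i => (h i, Stay).

Lemma acts_idle (ts : tapes) : acts ts (idle (heads ts)) = ts.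
Proof. by apply/funext => i; rewrite /acts /idle ffunE; case: (ts i). Qed.

(** The number is fuel, not the exact running time, so that costs can be rounded up. *)
Fixpoint runs (p : prog) (n : nat) (q : pstate p) (ts ts' : tapes) : Prop :=
  if n is n'.+1 then
    let: (o, w) := ptrans q (heads ts) in
    if o is Some q' then runs n' q' (acts ts w) ts' else acts ts w = ts'
  else False.

Definition exec (p : prog) (n : nat) (ts ts' : tapes) : Prop :=
  runs n (pentry p) ts ts'.

Lemma runs_le (p : prog) (m n : nat) (q : pstate p) (ts ts' : tapes) :
  m <= n -> runs m q ts ts' -> runs n q ts ts'.
Proof.
elim: m n q ts => [|m IH] [|n] q ts //= mn.
by case: (ptrans _ _) => [[q'|] w] //; apply: IH.
Qed.

Lemma exec_le (p : prog) (m n : nat) (ts ts' : tapes) :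
  exec p m ts ts' -> m <= n -> exec p n ts ts'.
Proof. by move=> pm mn; apply: runs_le pm. Qed.

Definition Do (g : reading -> writing) : prog :=
  @Prog unit tt (fun _ h => (None, g h)).

Definition Seq (p q : prog) : prog :=
  @Prog (pstate p + pstate q)%type (inl (pentry p)) (fun s h =>
    match s with
    | inl s1 => let: (o, w) := ptrans s1 h in
        (Some (if o is Some s' then inl s' else inr (pentry q)), w)
    | inr s2 => let: (o, w) := ptrans s2 h in (omap inr o, w)
    end).

Definition Cond (b : reading -> bool) (p q : prog) : prog :=
  @Prog (option (pstate p + pstate q)) None (fun s h =>
    match s with
    | None => (Some (Some (if b h then inl (pentry p) else inr (pentry q))),
               idle h)
    | Some (inl s1) => let: (o, w) := ptrans s1 h in
        (omap (fun s' => Some (inl s')) o, w)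
    | Some (inr s2) => let: (o, w) := ptrans s2 h in
        (omap (fun s' => Some (inr s')) o, w)
    end).

(** The test is made in state [None]; an ending body yields [o = None], and [Some o] then leads back
    to the test. *)
Definition While (b : reading -> bool) (p : prog) : prog :=
  @Prog (option (pstate p)) None (fun s h =>
    match s with
    | None => (if b h then Some (Some (pentry p)) else None, idle h)
    | Some s1 => let: (o, w) := ptrans s1 h in (Some o, w)
    end).

Lemma exec_do (g : reading -> writing) (ts ts' : tapes) :
  acts ts (g (heads ts)) = ts' -> exec (Do g) 1 ts ts'.
Proof. by []. Qed.

Lemma exec_seq (p q : prog) (m n : nat) (ts ts1 ts2 : tapes) :
  exec p m ts ts1 -> exec q n ts1 ts2 -> exec (Seq p q) (m + n) ts ts2.
Proof.
have right n' s t t' : runs n' s t t' ->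
    @runs (Seq p q) n' (inr s) t t'.
  elim: n' s t => //= n' IH s t.
  by case: (ptrans _ _) => [[s'|] w] //=; apply: IH.
rewrite /exec /=; elim: m (pentry p) ts => //= m IH s ts.
case: (ptrans _ _) => [[s'|] w] /=; first exact: IH.
by move=> -> q12; apply/right/runs_le/q12; rewrite leq_addl.
Qed.

Lemma exec_cond (b : reading -> bool) (p q : prog) (n : nat) (ts ts' : tapes) :
  exec (if b (heads ts) then p else q) n ts ts' ->
  exec (Cond b p q) n.+1 ts ts'.
Proof.
have left n' s t t' : runs n' s t t' ->
    @runs (Cond b p q) n' (Some (inl s)) t t'.
  elim: n' s t => //= n' IH s t.
  by case: (ptrans _ _) => [[s'|] w] //=; apply: IH.
have right n' s t t' : runs n' s t t' ->
    @runs (Cond b p q) n' (Some (inr s)) t t'.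
  elim: n' s t => //= n' IH s t.
  by case: (ptrans _ _) => [[s'|] w] //=; apply: IH.
rewrite /exec /= acts_idle; case: (b _); [exact: left|exact: right].
Qed.

Lemma exec_stop (b : reading -> bool) (p : prog) (ts : tapes) :
  b (heads ts) = false -> exec (While b p) 1 ts ts.
Proof. by rewrite /exec /= => ->; rewrite acts_idle. Qed.

Lemma exec_loop (b : reading -> bool) (p : prog) (m n : nat)
    (ts ts1 ts2 : tapes) :
  b (heads ts) -> exec p m ts ts1 -> exec (While b p) n ts1 ts2 ->
  exec (While b p) (m + n).+1 ts ts2.
Proof.
rewrite /exec /= => ->; rewrite acts_idle.
elim: m (pentry p) ts => //= m IH s ts.
case: (ptrans _ _) => [[s'|] w] /=; first exact: IH.
by move=> -> q12; apply/runs_le/q12; rewrite leq_addl.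
Qed.

Lemma exec_while (b : reading -> bool) (p : prog) (B m : nat)
    (f : nat -> tapes) :
  (forall i, i < m -> b (heads (f i)) /\ exec p B (f i) (f i.+1)) ->
  b (heads (f m)) = false ->
  exec (While b p) (m * B.+1).+1 (f 0) (f m).
Proof.
elim: m f => [|m IH] f Hf Hm; first exact: exec_stop.
have [b0 p0] := Hf 0 isT.
have /IH /(_ Hm) H i : i < m ->
    b (heads (f i.+1)) /\ exec p B (f i.+1) (f i.+2) by apply: (Hf i.+1).
by apply: exec_le (exec_loop b0 p0 H) _; rewrite mulSn; lia.
Qed.

(** A verdict depends on the state alone, so one more step, taken in [inr None], reads the heads and
    stores the answer in the state. *)
Definition deciding_machine (p : prog) (acc : reading -> bool) : machine :=
  @Machine k W (pstate p + option bool)%type (inl (pentry p))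
    (fun s => if s is inr o then o else None)
    (fun s h =>
       match s with
       | inl s1 => let: (o, w) := ptrans s1 h in
           (if o is Some s' then inl s' else inr None, w)
       | inr _ => (inr (Some (acc h)), idle h)
       end).

Lemma answers_within_exec (p : prog) (acc : reading -> bool) (x : seq bool)
    (n : nat) (ts : tapes) :
  exec p n (ctapes (init (deciding_machine p acc) x)) ts ->
  answers_within (deciding_machine p acc) x n.+1 (acc (heads ts)).
Proof.
set M := deciding_machine p acc.
have halted b m (c : config M) : verdict (cstate c) = Some b ->
    verdict (cstate (iter m (@step M) c)) = Some b.
  move=> H; have stepc : step c = c by rewrite /step H.
  by elim: m => //= m IH; move: (iterSr m (@step M) c); rewrite stepc /= => ->.
suff main m s t : runs m s t ts ->
    verdict (cstate (iter m.+1 (@step M) (@Config M (inl s) t))) =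
    Some (acc (heads ts)) by apply: main.
elim: m s t => // m IH s t H; rewrite iterSr; move: H => /=.
have -> : step (@Config M (inl s) t) =
    let: (o, w) := ptrans s (heads t) in
    @Config M (if o is Some s' then inl s' else inr None) (acts t w).
  by rewrite /step /= -/(heads t); case: (ptrans _ _).
case: (ptrans _ _) => [[s'|] w] /=; first exact: IH.
by move=> ->; rewrite -[step _]/(iter m.+1 (@step M) _) iterSr; apply: halted.
Qed.

End Programs.

(** * Moving heads over bounded tapes *)

Section TapeAt.
Variable C : Type.
Implicit Types (s : seq (option C)) (p : nat).

Definition tape_at s p : tape (option C) :=
  Tape (rev (take p s)) (nth None s p) (drop p.+1 s).

(** The bounds keep the head on listed cells: a step left from beyond the list would append a blank
    to it, giving a different [tape]. *)
Definition shifts (m : move) (n p p' : nat) : Prop :=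
  match m with
  | MoveL => p = p'.+1 /\ p < n
  | MoveR => p' = p.+1 /\ p' < n
  | Stay => p' = p
  end.

Lemma act_shift (m : move) s p p' :
  shifts m (size s) p p' ->
  act (tape_at s p) (nth None s p, m) = tape_at s p'.
Proof.
have right q : q.+1 < size s ->
    act (tape_at s q) (nth None s q, MoveR) = tape_at s q.+1.
  move=> qs; rewrite /tape_at /= (take_nth None) ?(ltnW qs) // rev_rcons.
  by rewrite (drop_nth None qs).
case: m => /= [[-> ps]|[-> ps]|->] //; last exact: right.
rewrite /tape_at /= (take_nth None) ?(ltnW ps) // rev_rcons /=.
by rewrite -(drop_nth None ps).
Qed.

Lemma act_write s p c : p < size s ->
  act (tape_at s p) (c, Stay) = tape_at (set_nth None s p c) p.
Proof.
move=> ps; rewrite /tape_at /= nth_set_nth /= eqxx.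
congr (Tape (rev _) _ _); rewrite set_nthE ps.
  by rewrite take_cat size_take ps ltnn subnn take0 cats0.
by rewrite drop_cat size_take ps ltnNge leqnSn /= subSnn /= drop0.
Qed.

End TapeAt.

(** * Layout of the tapes and loops over positions *)

Section Machine.
Variable P : finType.
Local Notation program := (prog 16 (bool + {set P})%type).

Definition symbol : Type := option (bool + (bool + {set P})).
Definition Start : symbol := Some (inr (inl true)).
Definition End : symbol := Some (inr (inl false)).
Definition Cell (s : {set P}) : symbol := Some (inr (inr s)).
Definition Bit (b : bool) : symbol := Some (inl b).

(** Apart from the input, the table and the stack, all tapes hold the same string: two counters, six
    variables and six dummies. *)
Definition index := 'I_17.
Definition inputT : index := @Ordinal 17 0 isT.
Definition tableT : index := @Ordinal 17 1 isT.
Definition stackT : index := @Ordinal 17 2 isT.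
Definition auxA : index := @Ordinal 17 3 isT.
Definition auxB : index := @Ordinal 17 4 isT.
Definition var (v : 'I_6) : index := rshift 5 (lshift 6 v).
Definition dummy (v : 'I_6) : index := rshift 5 (rshift 6 v).

(** Letters are at positions 1 to [size w]. Loops stop at [End], so variables range below
    [N = (size w).+1] and include the position 0 of [Start]. *)
Definition word (w : seq bool) : seq symbol := Start :: rcons (map Bit w) End.

Lemma size_word w : size (word w) = (size w).+2.
Proof. by rewrite /= size_rcons size_map. Qed.

Lemma word_Start w p : p <= (size w).+1 ->
  (nth None (word w) p == Start) = (p == 0).
Proof.
case: p => [|p] pw; rewrite ?eqxx //= nth_rcons size_map.
move: pw; rewrite ltnS leq_eqVlt => /predU1P [->|pw]; first by rewrite ltnn eqxx.
by rewrite pw (nth_map false).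
Qed.

Lemma word_End w p : p <= (size w).+1 ->
  (nth None (word w) p == End) = (p == (size w).+1).
Proof.
case: p => [|p] pw //=; rewrite nth_rcons size_map eqSS.
move: pw; rewrite ltnS leq_eqVlt => /predU1P [->|pw]; first by rewrite ltnn !eqxx.
by rewrite pw (nth_map false) // ltn_eqF.
Qed.

Definition tables := nat -> {set P}.

(** Rows of length [N] are stored one after another; the pair [(i, j)] has cell [i * N + j], found
    one position further because of [Start]. *)
Definition table_word (N : nat) (tb : tables) : seq symbol :=
  Start :: rcons (mkseq (fun i => Cell (tb i)) (N * N)) End.

Lemma size_table_word N tb : size (table_word N tb) = (N * N).+2.
Proof. by rewrite /= size_rcons size_mkseq. Qed.

Lemma nth_table_word N tb i : i < N * N ->
  nth None (table_word N tb) i.+1 = Cell (tb i).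
Proof. by move=> iN; rewrite /= nth_rcons size_mkseq iN nth_mkseq. Qed.

Lemma nth_table_word_end N tb : nth None (table_word N tb) (N * N).+1 = End.
Proof. by rewrite /= nth_rcons size_mkseq ltnn eqxx. Qed.

Lemma table_word_Start N tb p : p <= (N * N).+1 ->
  (nth None (table_word N tb) p == Start) = (p == 0).
Proof.
case: p => [|p] pN; rewrite ?eqxx //= nth_rcons size_mkseq.
move: pN; rewrite ltnS leq_eqVlt => /predU1P [->|pN]; first by rewrite ltnn eqxx.
by rewrite pN nth_mkseq.
Qed.

Definition upd (f : index -> nat) (x : index) (n : nat) : index -> nat :=
  fun i => if i == x then n else f i.

Lemma upd_same f x n : upd f x n x = n.
Proof. by rewrite /upd eqxx. Qed.

Lemma upd_id f x n : f x = n -> upd f x n = f.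
Proof. by move=> fx; apply/funext => i; rewrite /upd; case: eqP => // ->. Qed.

Definition Move (mt : move) (m : index -> move) : program :=
  Do (fun h i => (h i,
    match val i with 1 => mt | 0 | 2 => Stay | _ => m i end)).

Definition mv (x : index) (d : move) : index -> move :=
  fun i => if i == x then d else Stay.

Definition mv2 (x : index) (d : move) (y : index) (d' : move) : index -> move :=
  fun i => if i == x then d else if i == y then d' else Stay.

Definition rewind (x : index) : program :=
  While (fun h => h x != Start) (Move Stay (mv x MoveL)).

Definition rewind_table : program :=
  While (fun h => h tableT != Start) (Move MoveL (fun=> Stay)).

(* Adds the position of the head [x] to what [c] counts, using the tape A to
   bring the head [x] back. *)
Definition for_each_below (x : index) (c : program) :=
  Seq (While (fun h => h x != Start) (Seq (Move Stay (mv2 x MoveL auxA MoveR)) c))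
      (While (fun h => h auxA != Start) (Move Stay (mv2 auxA MoveL x MoveR))).

(** The head [auxB] takes exactly [N] steps from [Start] to [End], which is the length of a row. *)
Definition advance_row : program :=
  Seq (While (fun h => h auxB != End) (Move MoveR (mv auxB MoveR)))
      (rewind auxB).

Definition seek (x y : index) : program :=
  Seq rewind_table (Seq (Move MoveR (fun=> Stay))
    (Seq (for_each_below x advance_row)
         (for_each_below y (Move MoveR (fun=> Stay))))).

Definition for_all (x : index) (c : program) :=
  Seq (While (fun h => h x != End) (Seq c (Move Stay (mv x MoveR)))) (rewind x).

Section Run.
Variables (w : seq bool) (t0 t2 : tape symbol).
Let N := (size w).+1.

(** Once the equations are copied, tapes 0 and 2 are never touched again; they stay arbitrary
    parameters. *)
Definition layout (tt : tape symbol) (pos : index -> nat) :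
    index -> tape symbol :=
  fun i => match val i with
           | 0 => t0 | 1 => tt | 2 => t2
           | _ => tape_at (word w) (pos i)
           end.

Lemma heads_layout tt pos (x : index) : 2 < x ->
  heads (layout tt pos) x = nth None (word w) (pos x).
Proof. by rewrite ffunE /layout; case: x => -[|[|[|n]]]. Qed.

Lemma heads_tableT tt pos : heads (layout tt pos) tableT = thead tt.
Proof. by rewrite ffunE. Qed.

Lemma exec_Move mt m tt tt' pos pos' :
  act tt (thead tt, mt) = tt' ->
  (forall i : index, 2 < i -> shifts (m i) N.+1 (pos i) (pos' i)) ->
  exec (Move mt m) 1 (layout tt pos) (layout tt' pos').
Proof.
move=> Ht Hm; apply: exec_do; apply/funext => i; rewrite /acts ffunE /layout.
case E: (val i) => [|[|[|n]]] //; first by case: (t0).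
  by case: (t2).
apply: act_shift; rewrite size_word; apply: Hm.
by rewrite -[nat_of_ord i]/(val i) E.
Qed.

Lemma act_stay (tt : tape symbol) : act tt (thead tt, Stay) = tt.
Proof. by case: tt. Qed.

Lemma exec_rewind (x : index) tt pos : 2 < x -> pos x <= N ->
  exec (rewind x) (N * 2).+1 (layout tt pos) (layout tt (upd pos x 0)).
Proof.
move=> x2 xN; pose f i := layout tt (upd pos x (pos x - i)).
have -> : layout tt pos = f 0 by rewrite /f subn0 upd_id.
have -> : upd pos x 0 = upd pos x (pos x - pos x) by rewrite subnn.
apply: exec_le (exec_while (f := f) (m := pos x) (B := 1) _ _) _.
- move=> i ix; rewrite heads_layout // upd_same word_Start ?leq_subLR; last lia.
  split; first lia.
  apply: exec_Move => [|j j2]; first exact: act_stay.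
  by rewrite /mv /upd; case: eqP => //= _; rewrite /N; lia.
- by rewrite heads_layout // upd_same subnn word_Start.
- by rewrite ltnS leq_mul2r.
Qed.

Lemma exec_rewind_table tb p pos : p <= (N * N).+1 ->
  exec rewind_table ((N * N).+1 * 2).+1
    (layout (tape_at (table_word N tb) p) pos)
    (layout (tape_at (table_word N tb) 0) pos).
Proof.
move=> pN; pose f i := layout (tape_at (table_word N tb) (p - i)) pos.
have -> : layout (tape_at (table_word N tb) p) pos = f 0.
  by rewrite /f subn0.
have -> : layout (tape_at (table_word N tb) 0) pos = f p.
  by rewrite /f subnn.
apply: exec_le (exec_while (f := f) (m := p) (B := 1) _ _) _.
- move=> i ix; rewrite heads_tableT /= table_word_Start; last lia.
  split; first lia.
  apply: exec_Move => [|j j2] //.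
  by apply: act_shift; rewrite size_table_word /=; lia.
- by rewrite heads_tableT /= subnn table_word_Start.
- by rewrite ltnS leq_mul2r.
Qed.

(** The body runs while [x] and [auxA] are displaced, hence the arbitrary [pos']; it may rely on
    [auxB] only, which [advance_row] uses. *)
Lemma exec_for_each_below (x : index) c B (tt : nat -> tape symbol) pos :
  4 < x -> pos x <= N -> pos auxA = 0 ->
  (forall i pos', i < pos x -> pos' auxB = pos auxB ->
     exec c B (layout (tt i) pos') (layout (tt i.+1) pos')) ->
  exec (for_each_below x c) (N * B.+2 + N * 2 + 2)
    (layout (tt 0) pos) (layout (tt (pos x)) pos).
Proof.
move=> x4 xN A0 Hc.
have xA : x != auxA by apply: contraTneq x4 => ->.
have xB : x != auxB by apply: contraTneq x4 => ->.
(* After [i] rounds [x] is [i] cells further left and [auxA] is at [i]; the second loop runs through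
   these positions backwards. *)
pose q i := upd (upd pos x (pos x - i)) auxA i.
have q0 : q 0 = pos by rewrite /q subn0 !upd_id // /upd (negPf xA) ?upd_id.
have qx i : q i x = pos x - i by rewrite /q /upd (negPf xA) eqxx.
have qA i : q i auxA = i by rewrite /q upd_same.
pose f i := layout (tt i) (q i).
pose g i := layout (tt (pos x)) (q (pos x - i)).
have -> : layout (tt 0) pos = f 0 by rewrite /f q0.
have -> : layout (tt (pos x)) pos = g (pos x) by rewrite /g subnn q0.
apply: (@exec_le _ _ _ (((pos x * (1 + B).+1).+1) + (pos x * 1.+1).+1)); last first.
  have := leq_mul xN (leqnn B.+2); have := leq_mul xN (leqnn 2).
  by rewrite add1n; lia.
apply: (@exec_seq _ _ _ _ _ _ _ (f (pos x))).
  apply: (exec_while (f := f)) => [i ix|].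
    rewrite heads_layout ?(ltnW (ltnW x4)) // qx word_Start; last lia.
    split; first lia.
    apply: (@exec_seq _ _ _ _ _ _ _ (layout (tt i) (q i.+1))).
      apply: exec_Move => [|j j2]; first exact: act_stay.
      rewrite /mv2 /q /upd; case: (eqVneq j auxA) => [{j j2}->|jA].
        by rewrite eq_sym (negPf xA) /=; rewrite /N; lia.
      by case: eqP => //= _; rewrite /N; lia.
    by apply: Hc => //; rewrite /q /upd /= eq_sym (negPf xB).
  by rewrite heads_layout ?(ltnW (ltnW x4)) // qx subnn word_Start.
have -> : f (pos x) = g 0 by rewrite /f /g subn0.
apply: (exec_while (f := g)) => [i ix|].
  rewrite heads_layout // qA word_Start; last lia.
  split; first lia.
  apply: exec_Move => [|j j2]; first exact: act_stay.
  rewrite /mv2 /q /upd; case: eqP => [_|_] /=; first by rewrite /N; lia.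
  by case: eqP => //= _; rewrite /N; lia.
by rewrite heads_layout // qA subnn word_Start.
Qed.

Lemma exec_advance_row tb p pos : pos auxB = 0 -> p + N <= (N * N).+1 ->
  exec advance_row (N * 4 + 2)
    (layout (tape_at (table_word N tb) p) pos)
    (layout (tape_at (table_word N tb) (p + N)) pos).
Proof.
move=> B0 pN.
pose f i := layout (tape_at (table_word N tb) (p + i)) (upd pos auxB i).
have -> : layout (tape_at (table_word N tb) p) pos = f 0.
  by rewrite /f addn0 upd_id.
apply: (@exec_le _ _ _ ((N * 2).+1 + (N * 2).+1)); last lia.
apply: (@exec_seq _ _ _ _ _ _ _ (f N)).
  apply: (exec_while (f := f)) => [i iN|].
    rewrite heads_layout // upd_same word_End; last lia.
    split; first by rewrite -/N; lia.
    apply: exec_Move => [|j j2].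
      by apply: act_shift; rewrite size_table_word /=; lia.
    by rewrite /mv /upd; case: eqP => //= _; lia.
  by rewrite heads_layout // upd_same word_End // eqxx.
have {1}-> : pos = upd (upd pos auxB N) auxB 0.
  by apply/funext => i; rewrite /upd; case: eqP => // ->.
by apply: exec_rewind => //; rewrite upd_same.
Qed.

Definition seek_cost (n : nat) : nat :=
  ((n * n).+1 * 2).+1 + (1 + ((n * (n * 4 + 2).+2 + n * 2 + 2)
    + (n * 3 + n * 2 + 2))).

Lemma exec_seek (x y : index) tb p pos :
  4 < x -> 4 < y -> pos x < N -> pos y < N -> pos auxA = 0 -> pos auxB = 0 ->
  p <= (N * N).+1 ->
  exec (seek x y) (seek_cost N)
    (layout (tape_at (table_word N tb) p) pos)
    (layout (tape_at (table_word N tb) (pos x * N + pos y).+1) pos).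
Proof.
move=> x4 y4 xN yN A0 B0 pN.
have xyN : pos x * N + N <= N * N by rewrite -mulSnr leq_mul2r xN orbT.
apply: exec_seq; first exact: exec_rewind_table.
apply: (@exec_seq _ _ _ _ _ _ _ (layout (tape_at (table_word N tb) 1) pos)).
  apply: exec_Move => //.
  by apply: act_shift; rewrite size_table_word /=; lia.
pose r i := tape_at (table_word N tb) (i * N).+1.
pose s i := tape_at (table_word N tb) (pos x * N + i).+1.
apply: (@exec_seq _ _ _ _ _ _ _ (layout (r (pos x)) pos)).
  apply: (@exec_for_each_below _ _ _ r); rewrite ?(ltnW xN) // => i pos' ix Hb.
  rewrite /r mulSnr -addSn; apply: exec_advance_row; first by rewrite Hb.
  by rewrite addSn ltnS -mulSnr leq_mul2r (leq_trans ix) ?orbT // ltnW.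
have -> : r (pos x) = s 0 by rewrite /r /s addn0.
apply: (@exec_for_each_below _ _ _ s); rewrite ?(ltnW yN) // => i pos' iy _.
apply: exec_Move => [|j j2] //.
by apply: act_shift; rewrite size_table_word /= addnS; lia.
Qed.

Lemma exec_for_all (x : index) c B (tt : nat -> tape symbol) pos :
  2 < x -> pos x = 0 ->
  (forall i, i < N -> exec c B (layout (tt i) (upd pos x i))
                               (layout (tt i.+1) (upd pos x i))) ->
  exec (for_all x c) (N * B.+2 + N * 2 + 2) (layout (tt 0) pos)
    (layout (tt N) pos).
Proof.
move=> x2 x0 Hc.
pose f i := layout (tt i) (upd pos x i).
have -> : layout (tt 0) pos = f 0 by rewrite /f upd_id.
apply: (@exec_le _ _ _ ((N * (B + 1).+1).+1 + (N * 2).+1)); last first.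
  by rewrite addn1; lia.
apply: (@exec_seq _ _ _ _ _ _ _ (f N)).
  apply: (exec_while (f := f)) => [i iN|].
    rewrite heads_layout // upd_same word_End; last lia.
    split; first by rewrite -/N; lia.
    apply: exec_seq (Hc i iN) _.
    apply: exec_Move => [|j j2]; first exact: act_stay.
    by rewrite /mv /upd; case: eqP => //= _; lia.
  by rewrite heads_layout // upd_same word_End // eqxx.
have -> : layout (tt N) pos = layout (tt N) (upd (upd pos x N) x 0).
  by congr layout; apply/funext => i; rewrite /upd; case: eqP => // ->.
by apply: exec_rewind => //; rewrite upd_same.
Qed.

End Run.
End Machine.

(** * Evaluating Datalog rules *)

Definition poly_bounded (f : nat -> nat) : Prop :=
  exists C d, forall n, f n <= C * n.+1 ^ d.

Lemma poly_bounded_const c : poly_bounded (fun=> c).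
Proof. by exists c, 0 => n; rewrite expn0 muln1. Qed.

Lemma poly_bounded_id : poly_bounded id.
Proof. by exists 1, 1 => n; rewrite mul1n expn1. Qed.

(** Both exponents can be raised to [d + e] because the base [n.+1] is positive. *)
Lemma poly_bounded_add f g :
  poly_bounded f -> poly_bounded g -> poly_bounded (fun n => f n + g n).
Proof.
move=> [C [d Hf]] [D [e Hg]]; exists (C + D), (d + e) => n.
rewrite mulnDl; apply: leq_add.
  by apply: leq_trans (Hf n) _; rewrite leq_mul2l leq_pexp2l ?leq_addr ?orbT.
by apply: leq_trans (Hg n) _; rewrite leq_mul2l leq_pexp2l ?leq_addl ?orbT.
Qed.

Lemma poly_bounded_mul f g :
  poly_bounded f -> poly_bounded g -> poly_bounded (fun n => f n * g n).
Proof.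
move=> [C [d Hf]] [D [e Hg]]; exists (C * D), (d + e) => n.
by rewrite expnD mulnACA leq_mul.
Qed.

Lemma poly_bounded_succ f : poly_bounded f -> poly_bounded (fun n => (f n).+1).
Proof.
move=> Hf; have [C [d H]] := poly_bounded_add (poly_bounded_const 1) Hf.
by exists C, d => n; apply: H.
Qed.

Ltac poly_bound := repeat first
  [ assumption | exact: poly_bounded_const | exact: poly_bounded_id
  | apply: poly_bounded_succ | apply: poly_bounded_add
  | apply: poly_bounded_mul ].

Section Datalog.
Variable P : finType.
Notation program := (prog 16 (bool + {set P})%type).
Notation tables := (tables P).

Definition atom : Type := P * 'I_6 * 'I_6.
Definition rule : Type := atom * seq atom.

Definition add_fact (N : nat) (p : P) (i j : nat) (tb : tables) : tables :=
  fun k => if k == i * N + j then p |: tb k else tb k.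

Definition holds (N : nat) (tb : tables) (pos : index -> nat) (a : atom) :
    bool :=
  a.1.1 \in tb (pos (var a.1.2) * N + pos (var a.2)).

Definition transformer := nat -> (index -> nat) -> tables -> tables.

Definition apply_rule (r : rule) : transformer := fun N pos tb =>
  if all (holds N tb pos) r.2 then
    add_fact N r.1.1.1 (pos (var r.1.1.2)) (pos (var r.1.2)) tb
  else tb.

Definition apply_rules (rs : seq rule) : transformer := fun N pos tb =>
  foldl (fun tb' r => apply_rule r N pos tb') tb rs.

Definition iterate (x : index) (F : transformer) : transformer :=
  fun N pos tb => iteri N (fun i tb' => F N (upd pos x i) tb') tb.

(** Markers are kept, which makes harmless the write on [End] that occurs when the last position
    looks for its successor. *)
Definition put (p : P) (c : symbol P) : symbol P :=
  if c is Some (inr (inr s)) then Cell (p |: s) else c.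

Definition cell_has (p : P) (c : symbol P) : bool :=
  if c is Some (inr (inr s)) then p \in s else false.

Definition put_head (p : {ffun 'I_17 -> symbol P} -> P) : program :=
  Do (fun h i => (if val i == 1 then put (p h) (h i) else h i, Stay)).

Definition add_prog (p : P) (x y : index) : program :=
  Seq (seek P x y) (Seq (put_head (fun=> p)) (rewind_table P)).

(** The table is rewound in both cases, since [implements] requires its head to start and end on
    [Start]. *)
Definition test_prog (a : atom) (c : program) : program :=
  Seq (seek P (var a.1.2) (var a.2))
    (Cond (fun h => cell_has a.1.1 (h tableT)) (Seq (rewind_table P) c)
       (rewind_table P)).

Definition rule_prog (r : rule) : program :=
  foldr test_prog (add_prog r.1.1.1 (var r.1.1.2) (var r.1.2)) r.2.

Definition skip : program := Move P Stay (fun=> Stay).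

Definition rules_prog (rs : seq rule) : program :=
  foldr (fun r c => Seq (rule_prog r) c) skip rs.

Definition in_range (N : nat) (pos : index -> nat) : Prop :=
  [/\ pos auxA = 0, pos auxB = 0 & forall v, pos (var v) < N].

Definition table_tape (N : nat) (tb : tables) : tape (symbol P) :=
  tape_at (table_word N tb) 0.

(* The loops of [c] run on the heads [xs], which start and end at 0. *)
Definition implements (xs : seq index) (c : program) (F : transformer) : Prop :=
  exists2 cost, poly_bounded cost &
    forall w t0 t2 tb pos, let N := (size w).+1 in
      in_range N pos -> {in xs, forall x, pos x = 0} ->
      exec c (cost N) (layout w t0 t2 (table_tape N tb) pos)
                      (layout w t0 t2 (table_tape N (F N pos tb)) pos).

Lemma poly_bounded_seek : poly_bounded seek_cost.
Proof. by rewrite /seek_cost; poly_bound. Qed.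

Lemma fact_bound N i j : i < N -> j < N -> i * N + j < N * N.
Proof.
move=> iN jN; apply: (@leq_trans (i * N + N)); first by rewrite ltn_add2l.
by rewrite -mulSnr leq_mul2r iN orbT.
Qed.

Lemma table_word_add N p i j tb : i < N -> j < N ->
  set_nth None (table_word N tb) (i * N + j).+1
    (put p (nth None (table_word N tb) (i * N + j).+1)) =
  table_word N (add_fact N p i j tb).
Proof.
move=> iN jN; have k_lt := fact_bound iN jN.
apply: (@eq_from_nth _ None) => [|q].
  by rewrite size_set_nth !size_table_word; lia.
rewrite size_set_nth size_table_word => qN.
have -> T (x0 : T) s k y : nth x0 (set_nth x0 s k y) q =
    if q == k then y else nth x0 s q by rewrite nth_set_nth.
case: eqP => [->|qk]; first by rewrite !nth_table_word // /add_fact eqxx.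
case: q qN qk => [|q] qN qk //=; rewrite !nth_rcons !size_mkseq.
case: ifP => // qNN; rewrite !nth_mkseq // /add_fact.
by case: eqP => // kq; case: qk; rewrite kq.
Qed.

Lemma exec_put_head w t0 t2 g p i j tb pos (N := (size w).+1)
    (k := (i * N + j).+1) (ts := layout w t0 t2 (tape_at (table_word N tb) k) pos) :
  i < N -> j < N -> g (heads ts) = p ->
  exec (put_head g) 1 ts
    (layout w t0 t2 (tape_at (table_word N (add_fact N p i j tb)) k) pos).
Proof.
move=> iN jN gp; have k_lt := fact_bound iN jN.
have H : act (tape_at (table_word N tb) k)
    (put p (nth None (table_word N tb) k), Stay) =
    tape_at (table_word N (add_fact N p i j tb)) k.
  rewrite -(table_word_add p tb iN jN); apply: act_write.
  by rewrite size_table_word /k; lia.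
apply: exec_do; rewrite gp; apply/funext => q; rewrite /acts !ffunE /ts /layout.
by case: q => -[|[|[|q]]] Hq; [exact: act_stay|exact: H|exact: act_stay..].
Qed.

Lemma implements_add p x y :
  implements [::] (add_prog p (var x) (var y))
    (fun N pos => add_fact N p (pos (var x)) (pos (var y))).
Proof.
exists (fun N => seek_cost N + (1 + ((N * N).+1 * 2).+1)).
  by have := poly_bounded_seek => ?; poly_bound.
move=> w t0 t2 tb pos N [A0 B0 pN] _.
apply: exec_seq; first exact: exec_seek.
apply: exec_seq; first exact: exec_put_head.
apply: exec_rewind_table.
by have := fact_bound (pN x) (pN y); rewrite -/N; lia.
Qed.

Lemma implements_test a c F : implements [::] c F ->
  implements [::] (test_prog a c)
    (fun N pos tb => if holds N tb pos a then F N pos tb else tb).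
Proof.
move=> [cost Hcost Hc].
exists (fun N => seek_cost N + (((N * N).+1 * 2).+1 + cost N).+1).
  by have := poly_bounded_seek => ?; poly_bound.
move=> w t0 t2 tb pos N pos_ok xs0; have [A0 B0 pN] := pos_ok.
apply: exec_seq; first exact: exec_seek.
have k_lt := fact_bound (pN a.1.2) (pN a.2).
apply: exec_cond; rewrite heads_tableT [thead _](nth_table_word tb k_lt).
rewrite -[cell_has _ _]/(holds N tb pos a); case: ifP => _; last first.
  by apply: exec_le (exec_rewind_table _ _ _ _ _) _; rewrite ?leq_addr //; lia.
apply: exec_seq; last exact: Hc.
by apply: exec_rewind_table; lia.
Qed.

Lemma implements_ext xs c F G : implements xs c F ->
  (forall N pos tb, F N pos tb = G N pos tb) ->
  implements xs c G.
Proof.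
move=> [cost Hcost Hc] FG; exists cost => // w t0 t2 tb pos N ? ?.
by rewrite -FG; apply: Hc.
Qed.

Lemma implements_rule r : implements [::] (rule_prog r) (apply_rule r).
Proof.
case: r => [[[p x] y] body]; rewrite /rule_prog /=.
elim: body => [|a body IH] /=; first exact: implements_add.
apply: implements_ext (implements_test a IH) _ => N pos tb.
by rewrite /apply_rule /=; case: (holds _ _ _ _).
Qed.

Lemma implements_rules rs : implements [::] (rules_prog rs) (apply_rules rs).
Proof.
elim: rs => [|r rs [cost Hcost IH]] /=.
  exists (fun=> 1) => [|w t0 t2 tb pos N _ _]; first by poly_bound.
  by apply: exec_Move => //; apply: act_stay.
have [cost' Hcost' Hr] := implements_rule r.
exists (fun N => cost' N + cost N) => [|w t0 t2 tb pos N ? ?].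
  by poly_bound.
by apply: exec_seq; [apply: Hr|apply: IH].
Qed.

Lemma implements_for (x : index) (xs : seq index) c F :
  4 < x -> x \notin xs -> implements xs c F ->
  implements (x :: xs) (for_all x c) (iterate x F).
Proof.
move=> x4 xxs [cost Hcost Hc].
exists (fun N => N * (cost N).+2 + N * 2 + 2) => [|w t0 t2 tb pos N pos_ok xs0].
  by poly_bound.
have [A0 B0 pN] := pos_ok.
pose tt i := table_tape N (iteri i (fun j tb' => F N (upd pos x j) tb') tb).
apply: (@exec_for_all _ _ _ _ _ _ _ tt) => [||i iN].
- exact: ltnW (ltnW x4).
- by rewrite xs0 // mem_head.
apply: Hc => [|y yxs].
  split; rewrite /upd; try by rewrite ifN //; apply: contraTneq x4 => <-.
  by move=> v; case: eqP.
rewrite /upd; case: eqP => [yx|_]; first by rewrite -yx yxs in xxs.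
by rewrite xs0 // inE yxs orbT.
Qed.

Lemma implements_fors xs ys c F : all (fun x : index => 4 < x) ys ->
  uniq (ys ++ xs) -> implements xs c F ->
  implements (ys ++ xs) (foldr (@for_all P) c ys) (foldr iterate F ys).
Proof.
move=> + + cF; elim: ys => //= y ys IH /andP[y4 ys4] /andP[yn u].
exact: implements_for y4 yn (IH ys4 u).
Qed.

Definition variables : seq index := [seq var v | v <- enum 'I_6].
Definition dummies : seq index := [seq dummy v | v <- enum 'I_6].

(* The loops over the dummies repeat the loops over the variables [N ^ 6] times,
   which is more often than there are facts to derive. *)
Definition saturate_prog (rs : seq rule) : program :=
  foldr (@for_all P) (rules_prog rs) (dummies ++ variables).

Definition saturate (rs : seq rule) : transformer :=
  foldr iterate (apply_rules rs) (dummies ++ variables).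

Lemma implements_saturate rs :
  implements (dummies ++ variables) (saturate_prog rs) (saturate rs).
Proof.
rewrite -[dummies ++ variables]cats0.
apply: implements_fors (implements_rules rs).
  by rewrite all_cat !all_map; apply/andP; split; apply/allP.
have inj_var : injective var by move=> v v' /(congr1 val)[/val_inj].
have inj_dummy : injective dummy by move=> v v' /(congr1 val)[/val_inj].
rewrite cats0 cat_uniq (map_inj_uniq inj_var) (map_inj_uniq inj_dummy).
rewrite enum_uniq andbT /=.
apply/hasPn => _ /mapP[v _ ->]; apply/negP => /mapP[v' _].
by case=> vv'; have := ltn_ord v; have := ltn_ord v'; lia.
Qed.

End Datalog.

(** * Least models *)

Section LeastModel.
Variables (P : finType) (rs : seq (rule P)).
Implicit Types (tb : tables P) (pos : index -> nat) (I : P -> nat -> nat -> Prop).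
Implicit Types (F : transformer P).

Definition fact (N : nat) tb (p : P) (i j : nat) : Prop := p \in tb (i * N + j).

(** The Horn clause of a rule, curried so that its premises can be introduced or supplied one at a
    time. *)
Definition sat_rule (N : nat) I (r : rule P) : Prop :=
  forall e : 'I_6 -> nat, (forall v, e v < N) ->
    foldr (fun (a : atom P) Q => I a.1.1 (e a.1.2) (e a.2) -> Q)
          (I r.1.1.1 (e r.1.1.2) (e r.1.2)) r.2.

Definition sat_rules (N : nat) I (s : seq (rule P)) : Prop :=
  foldr (fun r Q => sat_rule N I r /\ Q) True s.

Definition vars_below (N : nat) pos : Prop := forall v, pos (var v) < N.

Definition facts_in (N : nat) tb I : Prop :=
  forall p i j, i < N -> j < N -> fact N tb p i j -> I p i j.

Lemma vars_below_upd N pos x i :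
  vars_below N pos -> i < N -> vars_below N (upd pos x i).
Proof. by move=> Hpos iN v; rewrite /upd; case: ifP. Qed.

Lemma fact_index_inj N i j i' j' : j < N -> j' < N ->
  i * N + j = i' * N + j' -> i = i' /\ j = j'.
Proof.
move=> jN j'N E; have N0 : 0 < N by apply: leq_ltn_trans jN.
have ii : i = i'.
  have := congr1 (divn^~ N) E.
  by rewrite !divnMDl // !divn_small // !addn0.
by split=> //; move: E; rewrite ii => /addnI.
Qed.

Lemma facts_in_rule N I r pos tb : sat_rule N I r -> vars_below N pos ->
  facts_in N tb I -> facts_in N (apply_rule r N pos tb) I.
Proof.
move=> Hr Hpos Htb; rewrite /apply_rule; case: ifP => // Hbody p i j iN jN.
rewrite /fact /add_fact; case: eqP => [E|_]; last exact: Htb.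
have [-> ->] := fact_index_inj jN (Hpos _) E.
case/setU1P=> [->|]; last first.
  by rewrite -/(fact N tb p _ _); apply: Htb; apply: Hpos.
have := Hr (pos \o var) Hpos; move: Hbody => {Hr E}.
elim: r.2 => //= a body IH /andP[Ha Hb] H; apply: IH Hb (H _).
by apply: Htb => //; apply: Hpos.
Qed.

Lemma facts_in_rules N I s pos tb : sat_rules N I s -> vars_below N pos ->
  facts_in N tb I -> facts_in N (apply_rules s N pos tb) I.
Proof.
move=> + Hpos; elim: s tb => //= r s IH tb [Hr Hs] Htb.
by apply: IH => //; apply: facts_in_rule.
Qed.

Lemma iterate_inv F x N pos tb (Q : tables P -> Prop) :
  (forall i tb', i < N -> Q tb' -> Q (F N (upd pos x i) tb')) -> Q tb ->
  Q (iterate x F N pos tb).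
Proof.
move=> HF Q0; rewrite /iterate; suff H n : n <= N ->
  Q (iteri n (fun i tb' => F N (upd pos x i) tb') tb) by exact: H.
by elim: n => //= n IH nN; apply: HF => //; apply/IH/ltnW.
Qed.

Lemma facts_in_iterates N I s xs pos tb : sat_rules N I s ->
  vars_below N pos -> facts_in N tb I ->
  facts_in N (foldr (@iterate P) (apply_rules s) xs N pos tb) I.
Proof.
move=> Hs; elim: xs pos tb => [|x xs IH] pos tb Hpos Htb /=.
  exact: facts_in_rules.
apply: (iterate_inv (Q := fun tb' => facts_in N tb' I)) => // i tb' iN Htb'.
by apply: IH => //; apply: vars_below_upd.
Qed.

(** * Growth of the table and fixed points *)

Definition table_le tb tb' : Prop := forall k, tb k \subset tb' k.

Lemma table_le_refl tb : table_le tb tb.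
Proof. by []. Qed.

Lemma table_le_trans tb1 tb2 tb3 :
  table_le tb1 tb2 -> table_le tb2 tb3 -> table_le tb1 tb3.
Proof. by move=> H12 H23 k; apply: subset_trans (H12 k) (H23 k). Qed.

Lemma table_le_anti tb tb' : table_le tb tb' -> table_le tb' tb -> tb = tb'.
Proof.
by move=> H H'; apply/funext => k; apply/eqP; rewrite eqEsubset H H'.
Qed.

Definition inflationary F : Prop := forall N pos tb, table_le tb (F N pos tb).

Lemma add_fact_le N p i j tb : table_le tb (add_fact N p i j tb).
Proof. by move=> k; rewrite /add_fact; case: ifP => // _; apply: subsetUr. Qed.

Lemma inflationary_rule r : inflationary (apply_rule r).
Proof.
move=> N pos tb; rewrite /apply_rule.
by case: ifP => _; [apply: add_fact_le|apply: table_le_refl].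
Qed.

Lemma inflationary_rules s : inflationary (apply_rules s).
Proof.
move=> N pos; elim: s => [|r s IH] tb //=.
exact: table_le_trans (inflationary_rule _ _ _ _) (IH _).
Qed.

Lemma inflationary_iterate x F : inflationary F -> inflationary (iterate x F).
Proof.
move=> HF N pos tb.
apply: (iterate_inv (Q := table_le tb)) => // i tb' _ H.
exact: table_le_trans H (HF _ _ _).
Qed.

Lemma inflationary_iterates xs F :
  inflationary F -> inflationary (foldr (@iterate P) F xs).
Proof. by move=> HF; elim: xs => //= x xs; apply: inflationary_iterate. Qed.

(** Rules only add facts, so when the whole list adds none, every intermediate table is squeezed
    between [tb] and [tb]. The same argument serves the loops in [fixed_iterate]. *)
Lemma fixed_rules s N pos tb : apply_rules s N pos tb = tb ->
  foldr (fun r Q => apply_rule r N pos tb = tb /\ Q) True s.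
Proof.
elim: s => //= r s IH E.
have Er : apply_rule r N pos tb = tb.
  apply: table_le_anti (inflationary_rule _ _ _ _).
  by rewrite -[X in table_le _ X]E; apply: inflationary_rules.
by split=> //; apply: IH; rewrite -{1}Er.
Qed.

Lemma fixed_iterate x F N pos tb : inflationary F ->
  iterate x F N pos tb = tb -> forall i, i < N -> F N (upd pos x i) tb = tb.
Proof.
move=> HF; pose it n := iteri n (fun i tb' => F N (upd pos x i) tb') tb.
rewrite -[iterate _ _ _ _ _]/(it N) => E i iN.
have mono m n : m <= n -> table_le (it m) (it n).
  move=> /subnKC <-; elim: (n - m) => [|k IH]; rewrite ?addn0 ?addnS //.
  exact: table_le_trans IH (HF _ _ _).
have fixed n : n <= N -> it n = tb.
  move=> nN; apply: table_le_anti.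
    by rewrite -[X in table_le _ X]E; apply: mono.
  exact: (mono 0).
by have := fixed i.+1 iN; rewrite /= -/(it i) fixed // ltnW.
Qed.

Definition override (xs : seq index) (e pos : index -> nat) : index -> nat :=
  foldl (fun p x => upd p x (e x)) pos xs.

Lemma override_mem xs e pos x : x \in xs -> override xs e pos x = e x.
Proof.
rewrite /override; elim/last_ind: xs => // xs y IH.
rewrite mem_rcons inE foldl_rcons /upd.
by case: eqP => [->|_ /= /IH].
Qed.

Lemma fixed_iterates xs F N pos tb e : inflationary F ->
  (forall i, e i < N) -> foldr (@iterate P) F xs N pos tb = tb ->
  F N (override xs e pos) tb = tb.
Proof.
move=> HF He; elim: xs pos => [|x xs IH] pos //= E.
by apply/IH/(fixed_iterate _ E) => //; apply: inflationary_iterates.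
Qed.

Definition closed (N : nat) tb : Prop :=
  forall pos, vars_below N pos -> apply_rules rs N pos tb = tb.

Lemma eq_apply_rules s N pos pos' tb : pos \o var =1 pos' \o var ->
  apply_rules s N pos tb = apply_rules s N pos' tb.
Proof.
move=> E; elim: s tb => //= r s IH tb; rewrite IH; congr apply_rules.
rewrite /apply_rule !(E _ : pos (var _) = pos' (var _)).
rewrite (@eq_all _ _ (holds N tb pos')) // => a.
by rewrite /holds !(E _ : pos (var _) = pos' (var _)).
Qed.

Lemma inord_var v : inord (var v - 5) = v.
Proof. by rewrite [var v - 5](addKn 5 v) inord_val. Qed.

Lemma closed_fixed N pos tb :
  foldr (@iterate P) (apply_rules rs) variables N pos tb = tb -> closed N tb.
Proof.
move=> E pos' Hpos'.
pose e (i : index) := pos' (var (inord (i - 5))).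
have He i : e i < N by apply: Hpos'.
rewrite -[RHS](fixed_iterates (inflationary_rules _) He E).
apply: eq_apply_rules => v /=.
rewrite override_mem ?map_f ?mem_enum // /e; by rewrite inord_var.
Qed.

Lemma closed_iterates N pos xs tb : closed N tb -> vars_below N pos ->
  foldr (@iterate P) (apply_rules rs) xs N pos tb = tb.
Proof.
move=> cl; elim: xs pos => [|x xs IH] pos Hpos /=; first exact: cl.
apply: (iterate_inv (Q := fun tb' => tb' = tb)) => // i tb' iN ->.
by apply: IH; apply: vars_below_upd.
Qed.

Lemma closed_sat N tb : closed N tb -> sat_rules N (fact N tb) rs.
Proof.
move=> cl; suff H s : (forall pos, vars_below N pos ->
    foldr (fun r Q => apply_rule r N pos tb = tb /\ Q) True s) ->
    sat_rules N (fact N tb) s.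
  by apply: H => pos Hpos; apply/fixed_rules/cl.
elim: s => //= r s IH H; split; last by apply: IH => pos /H[].
move=> e He; pose pos (i : index) := e (inord (i - 5)).
have posE v : pos (var v) = e v.
  by rewrite /pos inord_var.
have Hpos : vars_below N pos by move=> v; rewrite posE.
have [] := H pos Hpos => + _; rewrite /apply_rule !posE.
set b := all _ _ => E.
have {E b} : all (holds N tb pos) r.2 -> fact N tb r.1.1.1 (e r.1.1.2) (e r.1.2).
  rewrite -/b => bT; move: E; rewrite bT.
  move=> /(congr1 (@^~ (e r.1.1.2 * N + e r.1.2))).
  by rewrite /fact /add_fact eqxx => <-; apply: setU11.
elim: r.2 => [|a body IHb] /=; first exact.
move=> Hh Ha; apply: IHb => Hb; apply: Hh; rewrite Hb andbT.
by rewrite /holds !posE.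
Qed.

(** * Saturation by counting facts *)

Definition weight (N : nat) tb : nat := \sum_(k < N * N) #|tb k|.

Lemma weight_bound N tb : weight N tb <= N * N * #|P|.
Proof.
rewrite -[X in X * _]card_ord -sum_nat_const.
by apply: leq_sum => k _; apply: max_card.
Qed.

(** Tables are functions on all numbers while [weight] sees only [N * N] cells; this covers the
    others when equal weights must give equal tables. *)
Definition local F : Prop := forall N pos tb k, vars_below N pos ->
  N * N <= k -> F N pos tb k = tb k.

Lemma local_rules s : local (apply_rules s).
Proof.
move=> N pos tb k Hpos Nk; elim: s tb => //= r s IH tb; rewrite IH.
rewrite /apply_rule; case: ifP => // _; rewrite /add_fact ifN //.
apply: contraTneq Nk => ->; rewrite -ltnNge.
by apply: fact_bound; apply: Hpos.
Qed.

Lemma local_iterates xs F : local F -> local (foldr (@iterate P) F xs).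
Proof.
move=> HF N; elim: xs => [|x xs IH] pos tb k Hpos Nk /=; first exact: HF.
apply: (iterate_inv (Q := fun tb' => tb' k = tb k)) => // i tb' iN <-.
by apply: IH => //; apply: vars_below_upd.
Qed.

Lemma weight_eq N tb tb' : table_le tb tb' ->
  (forall k, N * N <= k -> tb' k = tb k) -> weight N tb' <= weight N tb ->
  tb' = tb.
Proof.
move=> le loc W; apply/funext => k.
case: (ltnP k (N * N)) => [kN|]; last exact: loc.
apply/eqP; rewrite eq_sym eqEcard le leqNgt; apply: contraTN W => lt.
rewrite -ltnNge /weight (bigD1 (Ordinal kN)) //= [ltnRHS](bigD1 (Ordinal kN)) //=.
by rewrite -addSn leq_add // leq_sum // => i _; apply/subset_leq_card/le.
Qed.

(** A closed table stays closed in all later rounds, so each further enclosing loop multiplies the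
    guaranteed gain by [N]. *)
Definition progress (F : transformer P) (s : nat -> nat) : Prop :=
  forall N pos tb, vars_below N pos ->
    closed N (F N pos tb) \/ weight N tb + s N <= weight N (F N pos tb).

Lemma progress_round :
  progress (foldr (@iterate P) (apply_rules rs) variables) (fun=> 1).
Proof.
move=> N pos tb Hpos; set tb' := foldr _ _ _ _ _ _.
have le : table_le tb tb'.
  exact: (inflationary_iterates _ (@inflationary_rules rs)).
case: (leqP (weight N tb') (weight N tb)) => [W|]; last by rewrite addn1; right.
have E : tb' = tb.
  apply: weight_eq le _ W => k.
  exact: (local_iterates _ (@local_rules rs)).
by left; rewrite E; apply: closed_fixed E.
Qed.

Lemma progress_iterates n xs :
  progress (foldr (@iterate P) (apply_rules rs) xs) (fun N => N ^ n) ->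
  forall x, progress (foldr (@iterate P) (apply_rules rs) (x :: xs))
    (fun N => N ^ n.+1).
Proof.
move=> HF x N pos tb Hpos /=; rewrite /iterate expnS.
set F := foldr _ _ xs.
pose it m := iteri m (fun i tb' => F N (upd pos x i) tb') tb.
suff H m : m <= N -> closed N (it m) \/ weight N tb + m * N ^ n <= weight N (it m).
  exact: (H N).
elim: m => [|m IH] mN; first by right; rewrite addn0.
have Hpos' := vars_below_upd x Hpos mN.
have [cl|W] := IH (ltnW mN).
  by left; rewrite /= -/(it m) /F closed_iterates.
have [cl|W'] := HF N (upd pos x m) (it m) Hpos'; [by left|right].
by apply: leq_trans W'; rewrite mulSn addnCA addnC leq_add2r.
Qed.

(** Otherwise the six dummies would yield [N ^ 6] facts, more than the [N * N * #|P|] that exist. *)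
Lemma closed_saturate N pos tb : vars_below N pos -> #|P| < N ^ 4 ->
  closed N (saturate rs N pos tb).
Proof.
move=> Hpos big; have prog n ds : size ds = n -> progress
    (foldr (@iterate P) (apply_rules rs) (ds ++ variables)) (fun N => N ^ n).
  elim: n ds => [|n IH] [|d ds] //=; first by move=> _; apply: progress_round.
  by case=> /IH H; apply: progress_iterates H d.
have size_dummies : size dummies = 6 by rewrite size_map size_enum_ord.
have [//|W] := prog 6 _ size_dummies N pos tb Hpos.
have := leq_trans W (weight_bound _ _); rewrite leqNgt => /negP[].
apply: (@leq_trans (N ^ 6)); last exact: leq_addl.
have N0 : 0 < N by case: N big {Hpos W} => //; rewrite exp0n.
by rewrite (expnD N 2 4) -mulnn ltn_pmul2l // muln_gt0 N0.
Qed.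

Lemma saturate_sat N pos tb : vars_below N pos -> #|P| < N ^ 4 ->
  sat_rules N (fact N (saturate rs N pos tb)) rs.
Proof. by move=> Hpos big; apply/closed_sat/closed_saturate. Qed.

Lemma saturate_inflationary : inflationary (saturate rs).
Proof. exact/inflationary_iterates/inflationary_rules. Qed.

Lemma saturate_least N pos tb I : vars_below N pos ->
  sat_rules N I rs -> facts_in N tb I -> facts_in N (saturate rs N pos tb) I.
Proof. by move=> Hpos Hrs Htb; apply: facts_in_iterates. Qed.

End LeastModel.

(** * Copying the equations from the input *)

Section Loops.
Variables (k : nat) (W : finType) (b : {ffun 'I_k.+1 -> option (bool + W)} -> bool).
Variable body : prog k W.
Notation tapes := ('I_k.+1 -> tape (option (bool + W))).

(** Stated with a continuation, because a phase of the parser covers several rounds of a loop that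
    has not ended yet. *)
Definition loops_to (n : nat) (ts ts' : tapes) : Prop :=
  forall m ts'', exec (While b body) m ts' ts'' ->
    exec (While b body) (n + m) ts ts''.

Lemma loops_to_trans m n ts1 ts2 ts3 : loops_to m ts1 ts2 ->
  loops_to n ts2 ts3 -> loops_to (m + n) ts1 ts3.
Proof. by move=> H12 H23 q ts H; rewrite -addnA; apply/H12/H23. Qed.

Lemma loops_to_step n ts ts' : b (heads ts) -> exec body n ts ts' ->
  loops_to n.+1 ts ts'.
Proof. by move=> ? ? m ts'' ?; rewrite addSn; apply: exec_loop; eassumption. Qed.

End Loops.

Section Copy.
Variable P : finType.
Notation program := (prog 16 (bool + {set P})%type).
Notation symbol := (symbol P).
Notation Start := (Start P).
Notation End := (End P).
Notation Bit := (Bit P).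

(* Only the equations may be copied, as the time bound does not cover the
   length of the signature that follows them; a pushdown parser detects where
   they end.  Its stack symbols announce what remains to be read: a function
   symbol and its arguments, further arguments, further equations, the
   right-hand side of an equation.  A function symbol is announced by the blank,
   so that moving right onto a blank cell pushes one. *)
Definition await_term : symbol := None.
Definition await_args : symbol := Bit true.
Definition await_eqs : symbol := Bit false.
Definition await_rhs : symbol := End.

(** The boolean tells whether the input bit is consumed; only the turn to a right-hand side consumes
    none. *)
Definition parse (top bit : symbol) : symbol * move * bool :=
  let one := bit == Bit true in
  if top == await_term then
    if one then (await_term, Stay, true) else (await_args, Stay, true)
  else if top == await_rhs then (await_eqs, MoveR, false)
  else if ~~ one then (None, MoveL, true)
  else (if top == await_args then await_args else await_rhs, MoveR, true).

Definition copy_step : program := Do (fun h i =>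
  let: (c, m, read) := parse (h stackT) (h inputT) in
  match val i with
  | 0 => (h i, if read then MoveR else Stay)
  | 1 => (h i, Stay)
  | 2 => (c, m)
  | _ => if read then (h inputT, MoveR) else (h i, Stay)
  end).

Definition copy_loop : program :=
  While (fun h => h stackT != Start) copy_step.

Definition growing (out : seq symbol) : tape symbol := Tape (rev out) None [::].

Lemma act_growing out c : act (growing out) (c, MoveR) = growing (rcons out c).
Proof. by rewrite /growing rev_rcons. Qed.

Lemma act_growing_last out c :
  act (growing out) (c, Stay) = tape_at (rcons out c) (size out).
Proof.
rewrite /tape_at nth_rcons ltnn eqxx -cats1 take_size_cat //.
by rewrite drop_oversize // size_cat addn1.
Qed.

(** Popping leaves blanks on the right; their number [m] must be carried along, as it distinguishes
    tapes that look the same to the machine. *)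
Definition stack_tape (s : seq symbol) (m : nat) : tape symbol :=
  Tape (behead (rcons s Start)) (head None (rcons s Start)) (nseq m None).

Definition copying (s : seq symbol) (inp out : seq bool) l m :
    index -> tape symbol :=
  fun i => match val i with
           | 0 => Tape l (head None (map Bit inp)) (behead (map Bit inp))
           | 1 => growing [::]
           | 2 => stack_tape s m
           | _ => growing (Start :: map Bit out)
           end.

Definition copies (n : nat) (s : seq symbol) (x : seq bool) (s' : seq symbol) :=
  forall r out l m, exists l' m',
    loops_to (fun h => h stackT != Start) copy_step n
      (copying s (x ++ r) out l m) (copying s' r (out ++ x) l' m').

Lemma copies_cat n n' s s' s'' x y : copies n s x s' -> copies n' s' y s'' ->
  copies (n + n') s (x ++ y) s''.
Proof.
move=> Hx Hy r out l m.
have [l' [m' H]] := Hx (y ++ r) out l m.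
have [l2 [m2 H2]] := Hy r (out ++ x) l' m'.
by exists l2, m2; rewrite -catA (catA out); apply: loops_to_trans H H2.
Qed.

Lemma copies_le n n' s x s' : copies n s x s' -> n <= n' -> copies n' s x s'.
Proof.
move=> Hx nn' r out l m; have [l' [m' H]] := Hx r out l m.
exists l', m' => q ts /H; move/exec_le; apply; by rewrite leq_add2r.
Qed.

Definition after (c : symbol) (m : move) (s : seq symbol) : seq symbol :=
  match m with
  | MoveL => s
  | Stay => c :: s
  | MoveR => [:: await_term, c & s]
  end.

Lemma act_stack_tape top s c m q : (m = MoveL -> c = None) ->
  exists q', act (stack_tape (top :: s) q) (c, m) = stack_tape (after c m s) q'.
Proof.
rewrite /stack_tape /=; case: m => [/(_ erefl) ->|_|_] /=.
- by exists q.+1; case: s.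
- by exists q.-1; case: q.
- by exists q.
Qed.

Lemma exec_copy_step top s inp out c m read l q :
  parse top (head None (map Bit inp)) = (c, m, read) ->
  (m = MoveL -> c = None) -> read <= (0 < size inp) ->
  exists l' q', exec copy_step 1 (copying (top :: s) inp out l q)
    (copying (after c m s) (if read then behead inp else inp)
       (if read then rcons out (head false inp) else out) l' q').
Proof.
move=> Hparse Hm Hread.
have [q' Hq] := act_stack_tape top s q Hm.
exists (if read then Bit (head false inp) :: l else l), q'.
apply: exec_do; rewrite !ffunE /= Hparse; apply/funext => i.
rewrite /acts ffunE /copying; case: i => -[|[|[|i]]] Hi //=.
- by case: read Hread {Hparse} => //; case: inp => [|b [|b' inp]].
- case: read Hread {Hparse} => //; case: inp => // b inp _ /=.
  by rewrite map_rcons -rcons_cons -act_growing.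
Qed.

Lemma copies_read top s b c m : top != Start ->
  parse top (Bit b) = (c, m, true) -> (m = MoveL -> c = None) ->
  copies 2 (top :: s) [:: b] (after c m s).
Proof.
move=> topS Hparse Hm r out l q.
have [l' [q' H]] := @exec_copy_step top s (b :: r) out c m true l q Hparse Hm isT.
exists l', q'; apply: loops_to_step; last by rewrite cats1.
by rewrite ffunE.
Qed.

Lemma copies_skip top s c : top != Start ->
  (forall bit, parse top bit = (c, MoveR, false)) ->
  copies 2 (top :: s) [::] (after c MoveR s).
Proof.
move=> topS Hparse r out l q.
have Hm : MoveR = MoveL -> c = None by [].
have [l' [q' H]] := exec_copy_step s out l q (Hparse _) Hm (leq0n (0 < size r)).
exists l', q'; apply: loops_to_step; last by rewrite cats0; apply: H.
by rewrite ffunE.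
Qed.

Lemma copies_nat s n :
  copies (2 * size (enc_nat n)) (await_term :: s) (enc_nat n) (await_args :: s).
Proof.
elim: n => [|n IH]; first exact: (@copies_read _ _ _ await_args Stay).
have H : copies 2 (await_term :: s) [:: true] (await_term :: s).
  exact: (@copies_read _ _ _ await_term Stay).
by apply: copies_le (copies_cat H IH) _; rewrite mulnS.
Qed.

Lemma copies_seq (T : Type) (enc : T -> seq bool) s (xs : seq T) :
  (forall x s', copies (2 * size (enc x)) (await_term :: s') (enc x) s') ->
  copies (2 * size (enc_seq enc xs)) (await_args :: s) (enc_seq enc xs) s.
Proof.
move=> Henc; elim: xs => [|x xs IH].
  exact: (@copies_read _ _ _ None MoveL).
have H : copies 2 (await_args :: s) [:: true] [:: await_term, await_args & s].
  exact: (@copies_read _ _ _ await_args MoveR).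
have := copies_cat H (copies_cat (Henc x _) IH).
rewrite /enc_seq /= rcons_cat => Hx.
by apply: copies_le Hx _; rewrite !size_cat /=; lia.
Qed.

(** The generated principle gives no hypothesis for the arguments, which are nested inside a finite
    function. *)
Lemma term_induction (S : signature) (Q : term S -> Prop) :
  (forall f (a : {ffun 'I_(arity f) -> term S}), (forall i, Q (a i)) -> Q (App a)) ->
  forall t, Q t.
Proof. by move=> H; fix IH 1 => -[f a]; apply: H => i; apply: IH. Qed.

Lemma copies_term (S : signature) (t : term S) s :
  copies (2 * size (enc_term t)) (await_term :: s) (enc_term t) s.
Proof.
elim/term_induction: t s => f a IH s /=; rewrite size_cat mulnDr.
by apply: copies_cat (copies_nat _ _) _; apply: copies_seq.
Qed.

(** A bit costs two steps, a test of the loop and a transition. The turn to the right-hand side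
    reads nothing and is charged to the bit announcing the equation, whence the factor 4. *)
Lemma copies_eqs (S : signature) (G : seq (equation S)) s :
  copies (4 * size (enc_seq (@enc_equation S) G)) (await_eqs :: s)
    (enc_seq (@enc_equation S) G) s.
Proof.
elim: G => [|e G IH].
  by apply: (@copies_le 2) => //; apply: (@copies_read _ _ _ None MoveL).
have H : copies 2 (await_eqs :: s) [:: true] [:: await_term, await_rhs & s].
  exact: (@copies_read _ _ _ await_rhs MoveR).
have H' : copies 2 (await_rhs :: s) [::] [:: await_term, await_eqs & s].
  exact: (@copies_skip _ _ await_eqs).
have := copies_cat H (copies_cat (copies_term e.1 _)
  (copies_cat H' (copies_cat (copies_term e.2 _) IH))).
rewrite /enc_seq /= rcons_cat /enc_equation -catA => He.
by apply: copies_le He _; rewrite !size_cat /=; lia.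
Qed.

End Copy.

(** * The evaluator *)

Section Evaluator.
Variables (P : finType) (rs : seq (rule P)).
Variables (first succ accepting : P) (bit : bool -> P).
Notation program := (prog 16 (bool + {set P})%type).
Notation symbol := (symbol P).
Notation tables := (tables P).

Definition write_stack (c : symbol) (m : move) : program :=
  Do (fun h i => if val i == 2 then (c, m) else (h i, Stay)).

Definition write_table (c : symbol) (m : move) : program :=
  Do (fun h i => if val i == 1 then (c, m) else (h i, Stay)).

Definition write_words (c : symbol) (m : move) : program :=
  Do (fun h i => if 2 < val i then (c, m) else (h i, Stay)).

(** The stack announces two lists of equations above [Start], so copying stops right before the
    signature. The heads of all copies move together, and [auxA] tells when they are back. *)
Definition read_prog : program :=
  Seq (write_stack (Start P) MoveR) (Seq (write_stack (await_eqs P) MoveR)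
  (Seq (write_stack (await_eqs P) Stay) (Seq (write_words (Start P) MoveR)
  (Seq (copy_loop P) (Seq (write_words (End P) Stay)
  (While (fun h => h auxA != Start P) (Move P Stay (fun=> MoveL)))))))).

Definition blank_table : tables := fun=> set0.

Definition build_prog : program :=
  Seq (write_table (Start P) MoveR)
  (Seq (for_all (var ord0) (for_all (var ord_max) (write_table (Cell set0) MoveR)))
  (Seq (write_table (End P) Stay) (rewind_table P))).

Definition mark (c : symbol) : P := if c is Some (inl b) then bit b else first.

(** The cell of [(i, i.+1)] is the right neighbour of that of [(i, i)], so one search serves both
    facts. *)
Definition input_facts_prog : program :=
  for_all (var ord0) (Seq (seek P (var ord0) (var ord0))
    (Seq (put_head (fun h => mark (h (var ord0))))
    (Seq (Move P MoveR (fun=> Stay))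
    (Seq (put_head (fun=> succ)) (rewind_table P))))).

Definition add_input_facts (w : seq bool) (i : nat) (tb : tables) : tables :=
  let N := (size w).+1 in
  let tb' := add_fact N (mark (nth None (word P w) i)) i i tb in
  if i.+1 < N then add_fact N succ i i.+1 tb' else tb'.

Definition input_facts (w : seq bool) : tables :=
  iteri (size w).+1 (add_input_facts w) blank_table.

(** The last move puts the table head on the cell of the pair [(0, 0)], where the answer is read. *)
Definition main_prog : program :=
  Seq read_prog (Seq build_prog (Seq input_facts_prog
    (Seq (saturate_prog rs) (Move P MoveR (fun=> Stay))))).

Definition final_table (w : seq bool) : tables :=
  saturate rs (size w).+1 (fun=> 0) (input_facts w).

Lemma exec_write_table w t0 t2 tt pos c m :
  exec (write_table c m) 1 (layout w t0 t2 tt pos)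
    (layout w t0 t2 (act tt (c, m)) pos).
Proof.
apply: exec_do; apply/funext => i; rewrite /acts !ffunE /layout.
by case: i => -[|[|[|i]]] Hi //=; apply: act_stay.
Qed.

Lemma exec_build w t0 t2 : let N := (size w).+1 in
  exec build_prog (1 + ((N * (N * 3 + N * 2 + 2).+2 + N * 2 + 2)
      + (1 + ((N * N).+1 * 2).+1)))
    (layout w t0 t2 (growing [::]) (fun=> 0))
    (layout w t0 t2 (table_tape N blank_table) (fun=> 0)).
Proof.
move=> N; pose r j := growing (Start P :: nseq j (Cell set0)).
have rS j : act (r j) (Cell set0, MoveR) = r j.+1.
  rewrite act_growing /r -[in RHS]addn1 nseqD cats1 //.
apply: exec_seq; first exact: exec_write_table.
rewrite (act_growing [::]) -[growing _]/(r 0).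
apply: (@exec_seq _ _ _ _ _ _ _ (layout w t0 t2 (r (N * N)) (fun=> 0))).
  apply: (@exec_for_all _ _ _ _ _ _ _ (fun i => r (i * N))) => // i iN.
  rewrite mulSnr -[in r (i * N)](addn0 (i * N)).
  apply: (@exec_for_all _ _ _ _ _ _ _ (fun j => r (i * N + j))) => // j jN.
  by rewrite addnS -rS; apply: exec_write_table.
apply: exec_seq; first exact: exec_write_table.
rewrite act_growing_last.
have -> : rcons (Start P :: nseq (N * N) (Cell set0)) (End P) =
    table_word N blank_table.
  rewrite rcons_cons; congr (_ :: rcons _ _); apply: (@eq_from_nth _ None).
    by rewrite size_mkseq size_nseq.
  by move=> i; rewrite size_nseq => iN; rewrite nth_nseq iN nth_mkseq.
by apply: exec_rewind_table; rewrite /= size_nseq.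
Qed.

Lemma exec_input_facts w t0 t2 : let N := (size w).+1 in
  exec input_facts_prog
    (N * (seek_cost N + (1 + (1 + (1 + ((N * N).+1 * 2).+1)))).+2 + N * 2 + 2)
    (layout w t0 t2 (table_tape N blank_table) (fun=> 0))
    (layout w t0 t2 (table_tape N (input_facts w)) (fun=> 0)).
Proof.
move=> N; pose it i := iteri i (add_input_facts w) blank_table.
apply: (@exec_for_all _ _ _ _ _ _ _ (fun i => table_tape N (it i))) => // i iN.
set pos := upd _ _ i; have posx : pos (var ord0) = i by rewrite /pos upd_same.
have k_lt := fact_bound iN iN.
apply: exec_seq; first by apply: exec_seek; rewrite ?posx.
rewrite posx; apply: exec_seq; first exact: exec_put_head.
rewrite heads_layout // posx.
set tb := add_fact _ _ _ _ _.
apply: (@exec_seq _ _ _ _ _ _ _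
  (layout w t0 t2 (tape_at (table_word N tb) (i * N + i.+1).+1) pos)).
  apply: exec_Move => //.
  by apply: act_shift; rewrite size_table_word /= addnS -/N; lia.
apply: (@exec_seq _ _ _ _ _ _ _
  (layout w t0 t2 (tape_at (table_word N (it i.+1)) (i * N + i.+1).+1) pos)).
  rewrite /it /= -/(it i) /add_input_facts -/N -/tb.
  case: ifP => i1N; first exact: exec_put_head.
  (* The last position has no successor: the head is then on [End], which [put] does not change. *)
  have iE : (i * N + i.+1) = N * N.
    have -> : i.+1 = N by lia.
    by rewrite -mulSnr; congr (_ * _); lia.
  have H : act (tape_at (table_word N tb) (N * N).+1)
      (put succ (nth None (table_word N tb) (N * N).+1), Stay) =
      tape_at (table_word N tb) (N * N).+1.
    have -> c : c = End P -> put succ c = c by move->.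
      exact: act_stay.
    exact: nth_table_word_end.
  rewrite iE; apply: exec_do; apply/funext => j; rewrite /acts !ffunE /layout.
  by case: j => -[|[|[|j]]] Hj; [exact: act_stay|exact: H|exact: act_stay..].
by apply: exec_rewind_table; rewrite -/N; lia.
Qed.

Definition read_cost (n : nat) : nat :=
  1 + (1 + (1 + (1 + (4 * n + 1 + (1 + (n * 2).+1))))).

Lemma exec_read (S : signature) (G1 G2 : seq (equation S)) (rest : seq bool) :
  let w := enc_seq (@enc_equation S) G1 ++ enc_seq (@enc_equation S) G2 in
  exists t0 t2, exec read_prog (read_cost (size w).+1)
    (ctapes (init (deciding_machine main_prog
                     (fun h => cell_has accepting (h tableT))) (w ++ rest)))
    (layout w t0 t2 (growing [::]) (fun=> 0)).
Proof.
move=> w; set N := (size w).+1.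
pose inp := map (Bit P) (w ++ rest).
pose ts0 : index -> tape symbol := fun i =>
  tape_of (if val i == 0 then inp else [::]).
rewrite -[ctapes _]/ts0.
have [l [m H]] := copies_cat (@copies_eqs P _ G1 [:: await_eqs P])
  (@copies_eqs P _ G2 [::]) rest [::] [::] 0.
exists (copying [::] rest w l m inputT), (copying [::] rest w l m stackT).
pose st t := fun i : index => if val i == 2 then t else ts0 i.
have st_write t c mm : exec (write_stack c mm) 1 (st t) (st (act t (c, mm))).
  apply: exec_do; apply/funext => i; rewrite /acts /st !ffunE.
  by case: eqP => // _; apply: act_stay.
have -> : ts0 = st (growing [::]).
  by apply/funext => -[[|[|[|i]]] Hi].
do 3 (apply: exec_seq; first exact: st_write).
apply: (@exec_seq _ _ _ _ _ _ _
  (copying [:: await_eqs P; await_eqs P] (w ++ rest) [::] [::] 0)).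
  apply: exec_do; apply/funext => i; rewrite /acts /st !ffunE /copying /ts0.
  by case: i => -[|[|[|i]]] Hi.
apply: (@exec_seq _ _ _ _ _ _ _ (copying [::] rest w l m)).
  apply: exec_le (H 1 _ (exec_stop _ _)) _; first by rewrite ffunE.
  by rewrite /N /w size_cat; lia.
apply: (@exec_seq _ _ _ _ _ _ _ (layout w (copying [::] rest w l m inputT)
    (copying [::] rest w l m stackT) (growing [::]) (fun=> N))).
  apply: exec_do; apply/funext => i; rewrite /acts !ffunE /layout.
  have Hend : act (growing (Start P :: map (Bit P) w)) (End P, Stay) =
      tape_at (word P w) N by rewrite act_growing_last /= size_map.
  by case: i => -[|[|[|i]]] Hi; [exact: act_stay..|exact: Hend].
pose f i := layout w (copying [::] rest w l m inputT)
    (copying [::] rest w l m stackT) (growing [::]) (fun=> N - i).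
have -> : (fun=> N) = (fun=> N - 0) :> (index -> nat) by rewrite subn0.
have -> : (fun=> 0) = (fun=> N - N) :> (index -> nat) by rewrite subnn.
apply: (exec_while (f := f)) => [i iN|].
  rewrite heads_layout // word_Start; last lia.
  split; first lia.
  apply: exec_Move => [|j j2]; first exact: act_stay.
  by rewrite /= -/N; lia.
by rewrite heads_layout // subnn word_Start.
Qed.

Lemma exec_main : exists2 cost, poly_bounded cost &
  forall (S : signature) (G1 G2 : seq (equation S)) (rest : seq bool),
  let w := enc_seq (@enc_equation S) G1 ++ enc_seq (@enc_equation S) G2 in
  answers_within
    (deciding_machine main_prog (fun h => cell_has accepting (h tableT)))
    (w ++ rest) (cost (size w).+1) (accepting \in final_table w 0).
Proof.
have [cost Hcost Hsat] := implements_saturate rs.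
pose build_cost N := 1 + ((N * (N * 3 + N * 2 + 2).+2 + N * 2 + 2)
      + (1 + ((N * N).+1 * 2).+1)).
pose facts_cost N := N * (seek_cost N +
  (1 + (1 + (1 + ((N * N).+1 * 2).+1)))).+2 + N * 2 + 2.
exists (fun N => (read_cost N + (build_cost N + (facts_cost N + (cost N + 1)))).+1).
  have := poly_bounded_seek.
  by rewrite /read_cost /build_cost /facts_cost => ?; poly_bound.
move=> S G1 G2 rest w; have [t0 [t2 Hread]] := exec_read G1 G2 rest.
pose ts := layout w t0 t2
  (tape_at (table_word (size w).+1 (final_table w)) 1) (fun=> 0).
have -> : (accepting \in final_table w 0) = cell_has accepting (heads ts tableT).
  by rewrite heads_tableT [thead _]nth_table_word.
apply: answers_within_exec.
apply: exec_seq; first exact: Hread.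
apply: exec_seq; first exact: exec_build.
apply: exec_seq; first exact: exec_input_facts.
apply: exec_seq; first exact: Hsat.
by apply: exec_Move => //; apply: act_shift; rewrite size_table_word.
Qed.

Lemma input_facts_in w I : let N := (size w).+1 in
  (forall i, i < N -> I (mark (nth None (word P w) i)) i i) ->
  (forall i, i.+1 < N -> I succ i i.+1) -> facts_in N (input_facts w) I.
Proof.
move=> N Hmark Hsucc; rewrite /input_facts -/N.
suff H n : n <= N -> facts_in N (iteri n (add_input_facts w) blank_table) I.
  exact: H.
have add_in tb p i j : i < N -> j < N -> I p i j -> facts_in N tb I ->
    facts_in N (add_fact N p i j tb) I.
  move=> iN jN Ip Htb q i' j' i'N j'N; rewrite /fact /add_fact.
  case: eqP => [E|_]; last exact: Htb.
  have [-> ->] := fact_index_inj j'N jN E.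
  by case/setU1P=> [->|] //; apply: Htb.
elim: n => [|n IH] nN /=; first by move=> p i j _ _; rewrite /fact inE.
rewrite /add_input_facts -/N; case: ifP => nN1.
  apply: (add_in _ _ _ _ nN nN1 (Hsucc n nN1)).
  exact: (add_in _ _ _ _ nN nN (Hmark n nN) (IH (ltnW nN))).
exact: (add_in _ _ _ _ nN nN (Hmark n nN) (IH (ltnW nN))).
Qed.

Lemma input_facts_mem w : let N := (size w).+1 in
  (forall i, i < N ->
     fact N (input_facts w) (mark (nth None (word P w) i)) i i) /\
  (forall i, i.+1 < N -> fact N (input_facts w) succ i i.+1).
Proof.
move=> N; rewrite /input_facts -/N.
have le i tb : table_le tb (add_input_facts w i tb).
  rewrite /add_input_facts; case: ifP => _; last exact: add_fact_le.
  exact: table_le_trans (add_fact_le _ _ _ _ _) (add_fact_le _ _ _ _ _).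
have mono n m : n <= m -> table_le (iteri n (add_input_facts w) blank_table)
    (iteri m (add_input_facts w) blank_table).
  move=> /subnKC <-; elim: (m - n) => [|k IH]; rewrite ?addn0 ?addnS //.
  exact: table_le_trans IH (le _ _).
have step p i j : i < N -> (forall tb, fact N (add_input_facts w i tb) p i j) ->
    fact N (iteri N (add_input_facts w) blank_table) p i j.
  by move=> iN H; apply: (subsetP (mono i.+1 N iN _)); apply: H.
split=> i iN; apply: step; rewrite ?(ltnW iN) // => tb.
  rewrite /fact /add_input_facts /add_fact -/N.
  by case: ifP => _; rewrite ?eqxx; [case: eqP => _|]; rewrite !inE eqxx ?orbT.
by rewrite /fact /add_input_facts /add_fact -/N iN eqxx setU11.
Qed.

End Evaluator.

(** * Congruence closure as a Datalog program *)

Lemma enc_seq_cons (T : Type) (enc : T -> seq bool) x xs :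
  enc_seq enc (x :: xs) = true :: enc x ++ enc_seq enc xs.
Proof. by rewrite /enc_seq /= rcons_cat. Qed.

Section CongruenceClosure.
Variables (S : signature) (G : seq (equation S)).
Variables (V : term S -> Prop) (E : term S -> term S -> Prop).
Hypothesis V_sub : forall f (a : {ffun 'I_(arity f) -> term S}) i,
  V (App a) -> V (a i).
Hypothesis E_refl : forall t, V t -> E t t.
Hypothesis E_sym : forall t u, E t u -> E u t.
Hypothesis E_trans : forall t u v, E t u -> E u v -> E t v.
Hypothesis E_cong : forall f (a b : {ffun 'I_(arity f) -> term S}),
  V (App a) -> V (App b) -> (forall i, E (a i) (b i)) -> E (App a) (App b).
Hypothesis E_eqs : forall e, e \in G -> [/\ V e.1, V e.2 & E e.1 e.2].

(* A homomorphism to sets of terms, mapping the terms of [V] to their classes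
   under [E]; its kernel is a congruence containing [G]. *)
Fixpoint eval (t : term S) : term S -> Prop :=
  let: App f a := t in fun u =>
    exists b : {ffun 'I_(arity f) -> term S},
      [/\ V (App b), forall i, eval (a i) = E (b i) & E (App b) u].

Lemma E_ext t u : V t -> V u -> E t = E u <-> E t u.
Proof.
move=> Vt Vu; split=> [->|tu]; first exact: E_refl.
apply/funext => v; apply/propext; split; first exact/E_trans/E_sym.
exact: E_trans.
Qed.

Lemma evalE t : V t -> eval t = E t.
Proof.
elim/term_induction: t => f a IH Va; apply/funext => u; apply/propext.
split=> [[b [Vb ab bu]]|au]; last first.
  by exists a; split=> // i; apply/IH/(V_sub i Va).
apply: E_trans bu; apply: E_cong => // i.
apply/E_ext; [exact: V_sub Va|exact: V_sub Vb|].
by rewrite -ab; apply/esym/IH/(V_sub i Va).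
Qed.

(** Conservativity: [sim] is contained in the kernel of [eval], and on [V] this kernel is [E]. Hence
    closing under the rules inside a subterm-closed set [V] already gives all consequences between
    its terms. *)
Lemma sim_closure t u : sim G t u -> V t -> V u -> E t u.
Proof.
move=> tu Vt Vu; apply/E_ext => //; rewrite -!evalE //.
apply: (tu (fun x y => eval x = eval y)) => [|e /E_eqs[V1 V2 E12]].
  split=> [//|//|x y z -> //|f a b ab] /=.
  apply/funext => x; apply/propext.
  by split=> -[c [Vc ac cx]]; exists c; split=> // i; rewrite -ac ab.
by rewrite !evalE //; apply/E_ext.
Qed.

End CongruenceClosure.

(** * The rules for deciding mutual entailment *)

Inductive predicate : Type :=
  | First | BitIs of bool | Succ | SymEnd | SameSym | TermEnd | ArgsEnd
  | Item of bool | Equiv of bool | EquivArgs of bool | Checked of bool | Accept.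

Definition code_predicate (p : predicate) : 'I_12 * bool :=
  match p with
  | First => (inord 0, true) | BitIs b => (inord 1, b) | Succ => (inord 2, true)
  | SymEnd => (inord 3, true) | SameSym => (inord 4, true)
  | TermEnd => (inord 5, true) | ArgsEnd => (inord 6, true)
  | Item b => (inord 7, b) | Equiv b => (inord 8, b)
  | EquivArgs b => (inord 9, b) | Checked b => (inord 10, b)
  | Accept => (inord 11, true)
  end.

Definition decode_predicate (c : 'I_12 * bool) : option predicate :=
  nth None [seq Some p | p <- [:: First; BitIs c.2; Succ; SymEnd; SameSym;
    TermEnd; ArgsEnd; Item c.2; Equiv c.2; EquivArgs c.2; Checked c.2; Accept]]
    c.1.

Lemma code_predicateK : pcancel code_predicate decode_predicate.
Proof. by case=> [|b||||||b|b|b|b|]; rewrite /decode_predicate /= inordK. Qed.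

HB.instance Definition _ := Finite.copy predicate (pcan_type code_predicateK).

Lemma card_predicate : #|{: predicate}| <= 24.
Proof.
by rewrite -(card_codom (pcan_inj code_predicateK));
  apply: leq_trans (max_card _) _; rewrite card_prod card_ord card_bool.
Qed.

Definition v0 : 'I_6 := @Ordinal 6 0 isT.
Definition v1 : 'I_6 := @Ordinal 6 1 isT.
Definition v2 : 'I_6 := @Ordinal 6 2 isT.
Definition v3 : 'I_6 := @Ordinal 6 3 isT.
Definition v4 : 'I_6 := @Ordinal 6 4 isT.
Definition v5 : 'I_6 := @Ordinal 6 5 isT.

(** Properties of one position are put on the diagonal. [Checked true] can start only where
    [Checked false] has reached the end of the first list, so a single positive fact expresses that
    both checks succeeded. *)
Definition syntax_rules : seq (rule predicate) := [::
  (SymEnd, v0, v1, [:: (BitIs false, v0, v0); (Succ, v0, v1)]);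
  (SymEnd, v0, v1, [:: (BitIs true, v0, v0); (Succ, v0, v2); (SymEnd, v2, v1)]);
  (SameSym, v0, v1, [:: (BitIs false, v0, v0); (BitIs false, v1, v1)]);
  (SameSym, v0, v1, [:: (BitIs true, v0, v0); (BitIs true, v1, v1);
    (Succ, v0, v2); (Succ, v1, v3); (SameSym, v2, v3)]);
  (TermEnd, v0, v1, [:: (SymEnd, v0, v2); (ArgsEnd, v2, v1)]);
  (ArgsEnd, v0, v1, [:: (BitIs false, v0, v0); (Succ, v0, v1)]);
  (ArgsEnd, v0, v1, [:: (BitIs true, v0, v0); (Succ, v0, v2);
    (TermEnd, v2, v3); (ArgsEnd, v3, v1)]);
  (Item false, v1, v1, [:: (First, v0, v0); (Succ, v0, v1)]);
  (Item true, v1, v1, [:: (Item false, v0, v0); (BitIs false, v0, v0);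
    (Succ, v0, v1)]);
  (Checked false, v1, v1, [:: (First, v0, v0); (Succ, v0, v1)]);
  (Checked true, v1, v1, [:: (Checked false, v0, v0); (BitIs false, v0, v0);
    (Succ, v0, v1)]);
  (Accept, v0, v0, [:: (First, v0, v0); (Checked true, v1, v1);
    (BitIs false, v1, v1)])].

(** Occurrences of the same term become equivalent through the congruence rules, starting from empty
    argument lists. The step for a nonempty argument list uses all six variables. *)
Definition closure_rules (b : bool) : seq (rule predicate) := [::
  (Item b, v3, v3, [:: (Item b, v0, v0); (BitIs true, v0, v0); (Succ, v0, v1);
    (TermEnd, v1, v2); (TermEnd, v2, v3)]);
  (Equiv b, v1, v2, [:: (Item b, v0, v0); (BitIs true, v0, v0); (Succ, v0, v1);
    (TermEnd, v1, v2)]);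
  (Equiv b, v0, v1, [:: (Equiv b, v1, v0)]);
  (Equiv b, v0, v1, [:: (Equiv b, v0, v2); (Equiv b, v2, v1)]);
  (Equiv b, v0, v1, [:: (SameSym, v0, v1); (SymEnd, v0, v2); (SymEnd, v1, v3);
    (EquivArgs b, v2, v3)]);
  (EquivArgs b, v0, v1, [:: (BitIs false, v0, v0); (BitIs false, v1, v1)]);
  (EquivArgs b, v0, v1, [:: (BitIs true, v0, v0); (BitIs true, v1, v1);
    (Succ, v0, v2); (Succ, v1, v3); (Equiv b, v2, v3);
    (TermEnd, v2, v4); (TermEnd, v3, v5); (EquivArgs b, v4, v5)]);
  (Checked b, v3, v3, [:: (Checked b, v0, v0); (BitIs true, v0, v0);
    (Succ, v0, v1); (TermEnd, v1, v2); (TermEnd, v2, v3);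
    (Equiv (~~ b), v1, v2)])].

Definition rules : seq (rule predicate) :=
  syntax_rules ++ closure_rules false ++ closure_rules true.

Lemma sat_rules_cat N I (s s' : seq (rule predicate)) :
  sat_rules N I (s ++ s') <-> sat_rules N I s /\ sat_rules N I s'.
Proof. by elim: s => [|r s IH] /=; rewrite ?IH; intuition. Qed.

(* [reads p s q]: the string [s] occupies the positions from [p] to [q - 1] of
   [w], the first letter of [w] being at position 1. *)
Section Reads.
Variable w : seq bool.

Definition bit_at (p : nat) (b : bool) : Prop :=
  0 < p <= size w /\ nth false w p.-1 = b.

Fixpoint reads (p : nat) (s : seq bool) (q : nat) : Prop :=
  if s is b :: s' then bit_at p b /\ reads p.+1 s' q else p = q.

Lemma reads_size p s q : reads p s q -> q = p + size s.
Proof.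
elim: s p => [|b s IH] p /=; first by move=> ->; rewrite addn0.
by case=> _ /IH ->; rewrite addSnnS.
Qed.

Lemma reads_cat p s s' q :
  reads p (s ++ s') q <-> exists2 m, reads p s m & reads m s' q.
Proof.
elim: s p => [|b s IH] p /=.
  by split=> [H|[m -> //]]; exists p.
split=> [[pb /IH[m H H']]|[m [pb H] H']]; first by exists m.
by split=> //; apply/IH; exists m.
Qed.

Lemma bit_at_inj p b b' : bit_at p b -> bit_at p b' -> b = b'.
Proof. by case=> _ <- [_ <-]. Qed.

Lemma reads_nat_inj p m n q r : reads p (enc_nat m) q -> reads p (enc_nat n) r ->
  m = n /\ q = r.
Proof.
elim: m n p => [|m IH] [|n] p /= [pb Hq] [pb' Hr].
- by rewrite -Hq -Hr.
- by have := bit_at_inj pb pb'.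
- by have := bit_at_inj pb pb'.
- by have [-> ->] := IH _ _ Hq Hr.
Qed.

Lemma reads_seq_inj (T : eqType) (U : Type) (enc : U -> seq bool)
    (a b : T -> U) (xs : seq T) p q r :
  (forall x p q r, x \in xs -> reads p (enc (a x)) q -> reads p (enc (b x)) r ->
     a x = b x /\ q = r) ->
  reads p (enc_seq (enc \o a) xs) q -> reads p (enc_seq (enc \o b) xs) r ->
  {in xs, a =1 b} /\ q = r.
Proof.
elim: xs p => [|x xs IH] p H; first by move=> [_ <-] [_ <-].
rewrite !enc_seq_cons /= => -[_ /reads_cat[m Ha Hq]] [_ /reads_cat[m' Hb Hr]].
have [abx mm] := H x _ _ _ (mem_head _ _) Ha Hb.
rewrite -{}mm in Hr; have [|abxs qr] := IH m _ Hq Hr.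
  by move=> y p' q' r' yxs; apply: H; rewrite inE yxs orbT.
by split=> // y; rewrite inE => /predU1P[->|/abxs].
Qed.

(** The encoding is a prefix code, so a position determines the term that starts there and its
    end. *)
Lemma reads_term_inj (S : signature) (t u : term S) p q r :
  reads p (enc_term t) q -> reads p (enc_term u) r -> t = u /\ q = r.
Proof.
elim/term_induction: t u p q r => f a IH [g b] p q r /=.
move=> /reads_cat[m Hf Ha] /reads_cat[m' Hg Hb].
have [fg mm] := reads_nat_inj Hf Hg; move: fg => /val_inj fg.
subst g m'; have [|ab <-] := reads_seq_inj _ Ha Hb.
  by move=> i p' q' r' _; apply: IH.
by split=> //; congr App; apply/ffunP => i; apply: ab; rewrite mem_enum.
Qed.

End Reads.

(** * Soundness of the rules *)

Lemma reads_infix x s y :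
  reads (x ++ s ++ y) (size x).+1 s (size x + size s).+1.
Proof.
elim: s x => [|b s IH] x /=; first by rewrite addn0.
split; last by have := IH (rcons x b); rewrite cat_rcons size_rcons addSnnS.
by split; rewrite /= ?size_cat ?nth_cat ?ltnn ?subnn //=; lia.
Qed.

Section Input.
Variables (S : signature) (G : bool -> seq (equation S)).

Definition enc_eqs (s : seq (equation S)) : seq bool :=
  enc_seq (@enc_equation S) s.

Definition input : seq bool := enc_eqs (G false) ++ enc_eqs (G true).
Let w := input.
Let N := (size w).+1.

Definition derivable (b : bool) (s : seq (equation S)) : Prop :=
  forall e, e \in s -> sim (G b) e.1 e.2.

(* At position [p] the last equations of [G b], listed in [suf], remain. *)
Definition remaining (b : bool) (p : nat) (suf : seq (equation S)) : Prop :=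
  exists2 q, reads w p (enc_eqs suf) q &
    if b then q = N else reads w q (enc_eqs (G true)) N.

Lemma remaining_start : remaining false 1 (G false).
Proof.
exists (size (enc_eqs (G false))).+1; first exact: (reads_infix [::]).
rewrite /N /w /input size_cat.
by have := reads_infix (enc_eqs (G false)) (enc_eqs (G true)) [::]; rewrite cats0.
Qed.

Lemma remaining_nil b p suf : remaining b p suf -> bit_at w p false -> suf = [::].
Proof.
case=> q; case: suf => // e suf; rewrite /enc_eqs enc_seq_cons => -[pb _] _ pb'.
by have := bit_at_inj pb pb'.
Qed.

Lemma remaining_next p suf : remaining false p suf -> bit_at w p false ->
  remaining true p.+1 (G true).
Proof.
move=> H pb; have E := remaining_nil H pb; case: H => q; rewrite E => -[_ <-] H.
by exists N.
Qed.

Lemma remaining_cons b p suf : remaining b p suf -> bit_at w p true ->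
  exists e suf' q r, [/\ suf = e :: suf', reads w p.+1 (enc_term e.1) q,
    reads w q (enc_term e.2) r & remaining b r suf'].
Proof.
case=> q; case: suf => [|e suf].
  by move=> [pb _] _ pb'; have := bit_at_inj pb pb'.
rewrite /enc_eqs enc_seq_cons /enc_equation => -[_ /reads_cat[m +]].
move=> /reads_cat[l H1 H2] H3 H4 _; exists e, suf, l, m; split=> //.
by exists q.
Qed.

Definition half_sym (p q : nat) : Prop := forall f r,
  reads w p (enc_nat f) r -> exists r', reads w q (enc_nat f) r'.

(** The existence of a term at [q] is asserted, not assumed: this keeps transitivity sound when the
    middle position could be one without a term. Being directed, the relation is symmetrized by
    [sym2]. *)
Definition half_equiv (b : bool) (p q : nat) : Prop := forall (t : term S) r,
  reads w p (enc_term t) r ->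
  exists u r', reads w q (enc_term u) r' /\ sim (G b) t u.

(** Any list [xs] of indices is allowed, as the rules descend through tails of an argument list. It
    is duplicate-free so that [c] can be built by setting one value after another. *)
Definition half_args (b : bool) (p q : nat) : Prop :=
  forall n (xs : seq 'I_n) (a : 'I_n -> term S) r, uniq xs ->
  reads w p (enc_seq (@enc_term S \o a) xs) r ->
  exists c r', reads w q (enc_seq (@enc_term S \o c) xs) r' /\
    forall x, x \in xs -> sim (G b) (a x) (c x).

Definition sym2 (R : nat -> nat -> Prop) p q : Prop := R p q /\ R q p.

(* Most of [w] is not a term over the signature (nor a list of arguments), so
   the facts about terms only speak of the positions where there is one. *)
Definition intended (f : predicate) (p q : nat) : Prop :=
  match f with
  | First => p = 0
  | BitIs b => bit_at w p b
  | Succ => q = p.+1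
  | SymEnd => forall f r, reads w p (enc_nat f) r -> q = r
  | SameSym => sym2 half_sym p q
  | TermEnd => forall (t : term S) r, reads w p (enc_term t) r -> q = r
  | ArgsEnd => forall n (xs : seq 'I_n) (a : 'I_n -> term S) r,
      reads w p (enc_seq (@enc_term S \o a) xs) r -> q = r
  | Item b => exists pre suf, G b = pre ++ suf /\ remaining b p suf
  | Equiv b => sym2 (half_equiv b) p q
  | EquivArgs b => sym2 (half_args b) p q
  | Checked b => exists pre suf, [/\ G b = pre ++ suf, remaining b p suf,
      derivable (~~ b) pre & b -> derivable true (G false)]
  | Accept => derivable true (G false) /\ derivable false (G true)
  end.

Lemma half_sym_step p q : bit_at w p true -> bit_at w q true ->
  half_sym p.+1 q.+1 -> half_sym p q.
Proof.
move=> p1 q1 H [|f] r /= [pb]; first by have := bit_at_inj pb p1.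
by move=> /H[r' Hr']; exists r'.
Qed.

Lemma half_equiv_app b p q p' q' : half_sym p q -> intended SymEnd p p' ->
  intended SymEnd q q' -> half_args b p' q' -> half_equiv b p q.
Proof.
move=> Hs Hp Hq Ha [f a] r /reads_cat[m Hm Hr].
have E := Hp _ _ Hm; rewrite -{}E in Hr.
have [m' Hm'] := Hs _ _ Hm.
have [c [r' [Hr' ac]]] := Ha _ _ _ _ (enum_uniq _) Hr.
exists (App [ffun i => c i]), r'; split.
  apply/reads_cat; exists m' => //; rewrite -(Hq _ _ Hm').
  suff -> : (fun i => enc_term ([ffun i0 => c i0] i)) = @enc_term S \o c by [].
  by apply/funext => i; rewrite ffunE.
apply: (cong_op (sim_congruence (G b))) => i.
by rewrite ffunE; apply: ac; rewrite mem_enum.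
Qed.

Lemma half_args_nil b p q : bit_at w p false -> bit_at w q false ->
  half_args b p q.
Proof.
move=> p0 q0 n [|x xs] a r _; last first.
  by rewrite enc_seq_cons => -[pb]; have := bit_at_inj pb p0.
by move=> _; exists a, q.+1.
Qed.

Lemma half_args_cons b p q p' q' : bit_at w p true -> bit_at w q true ->
  half_equiv b p.+1 q.+1 -> intended TermEnd p.+1 p' ->
  intended TermEnd q.+1 q' -> half_args b p' q' -> half_args b p q.
Proof.
move=> p1 q1 He Hp Hq Ha n [|x xs] a r.
  by move=> _ [pb]; have := bit_at_inj pb p1.
rewrite enc_seq_cons cons_uniq => /andP[xxs u] [_ /reads_cat[m Hm Hr]].
have E := Hp _ _ Hm; rewrite -{}E in Hr.
have [t [m' [Hm' at']]] := He _ _ Hm.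
have [c [r' [Hr' ac]]] := Ha _ _ _ _ u Hr.
(* By uniqueness [x] is not in the tail, so the tail is still encoded as with [c]. *)
exists (fun y => if y == x then t else c y), r'; split; last first.
  by move=> y; rewrite inE; case: eqP => [-> _|_ /ac].
rewrite enc_seq_cons; split=> //; apply/reads_cat.
exists m'; first by rewrite /= eqxx.
rewrite -(Hq _ _ Hm'); suff <- : enc_seq (@enc_term S \o c) xs =
    enc_seq (@enc_term S \o (fun y => if y == x then t else c y)) xs by [].
congr (rcons (flatten _) _); apply/eq_in_map => y yxs /=.
by case: eqP => // yx; rewrite -yx yxs in xxs.
Qed.

Lemma intended_syntax : sat_rules N intended syntax_rules.
Proof.
rewrite /sat_rules /=.
repeat match goal with |- _ /\ _ => split end; last by []; move=> e _ /=.
- move=> p0 -> [|f] r /= [pb]; first by [].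
  by have := bit_at_inj pb p0.
- move=> p1 -> H [|f] r /= [pb]; last exact: H.
  by have := bit_at_inj pb p1.
- move=> p0 q0; split=> -[|f] r /= [pb] _.
  + by exists (e v1).+1.
  + by have := bit_at_inj pb p0.
  + by exists (e v0).+1.
  + by have := bit_at_inj pb q0.
- by move=> p1 q1 -> -> [H H']; split; apply: half_sym_step.
- move=> Hs Ha [f a] r /reads_cat[m Hm Hr].
  by apply: Ha; rewrite (Hs _ _ Hm); apply: Hr.
- move=> p0 -> n [|x xs] a r; first by case.
  by rewrite enc_seq_cons => -[pb]; have := bit_at_inj pb p0.
- move=> p1 -> Ht Ha n [|x xs] a r.
    by move=> [pb]; have := bit_at_inj pb p1.
  rewrite enc_seq_cons => -[_ /reads_cat[m Hm Hr]].
  by apply: (Ha _ _ a); rewrite (Ht _ _ Hm); apply: Hr.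
- by move=> -> ->; exists [::], (G false); split=> //; apply: remaining_start.
- move=> [pre [suf [_ H]]] p0 ->; exists [::], (G true); split=> //.
  exact: remaining_next H p0.
- move=> -> ->; exists [::], (G false); split=> //; exact: remaining_start.
- move=> [pre [suf [E H Hpre _]]] p0 ->; exists [::], (G true); split=> //.
    exact: remaining_next H p0.
  by move=> _; rewrite E (remaining_nil H p0) cats0.
- move=> _ [pre [suf [E H Hpre /(_ isT) ?]]] p0; split=> //.
  by rewrite E (remaining_nil H p0) cats0.
Qed.

Lemma intended_closure b : sat_rules N intended (closure_rules b).
Proof.
rewrite /sat_rules /=.
repeat match goal with |- _ /\ _ => split end; last by []; move=> e _ /=.
- move=> [pre [suf [E H]]] p1 -> H1 H2.
  have [x [suf' [q [r [Es Hq Hr Hsuf]]]]] := remaining_cons H p1.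
  exists (rcons pre x), suf'; split; first by rewrite cat_rcons -Es.
  suff -> : e v3 = r by [].
  by apply: H2; rewrite (H1 _ _ Hq); apply: Hr.
- move=> [pre [suf [E H]]] p1 -> H1.
  have [x [suf' [q [r [Es Hq Hr Hsuf]]]]] := remaining_cons H p1.
  rewrite (H1 _ _ Hq).
  have Gx : sim (G b) x.1 x.2.
    by move=> R _; apply; rewrite E Es mem_cat mem_head orbT.
  split=> t m Hm.
    have [-> _] := reads_term_inj Hm Hq.
    by exists x.2, r.
  have [-> _] := reads_term_inj Hm Hr.
  by exists x.1, q; split=> //; apply: (cong_sym (sim_congruence _)).
- by case.
- move=> [H1 H1'] [H2 H2']; split=> t r.
    move=> /H1[u [r' [/H2[v [m [Hm uv]]] tu]]]; exists v, m; split=> //.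
    exact: (cong_trans (sim_congruence _)) tu uv.
  move=> /H2'[u [r' [/H1'[v [m [Hm uv]]] tu]]]; exists v, m; split=> //.
  exact: (cong_trans (sim_congruence _)) tu uv.
- by move=> [H1 H1'] H2 H3 [H4 H4']; split; apply: half_equiv_app; eassumption.
- by move=> p0 q0; split; apply: half_args_nil.
- move=> p1 q1 -> -> [H1 H1'] H2 H3 [H4 H4'].
  by split; apply: half_args_cons; eassumption.
- move=> [pre [suf [E H Hpre Hb]]] p1 -> H1 H2 [He _].
  have [x [suf' [q [r [Es Hq Hr Hsuf]]]]] := remaining_cons H p1.
  exists (rcons pre x), suf'; split=> //; first by rewrite cat_rcons -Es.
    suff -> : e v3 = r by [].
    by apply: H2; rewrite (H1 _ _ Hq); apply: Hr.
  move=> y; rewrite mem_rcons inE => /predU1P[->|/Hpre //].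
  (* The equivalent term [u] is read where the right-hand side starts, hence equals it. *)
  have [u [r' [Hr' xu]]] := He _ _ Hq; rewrite (H1 _ _ Hq) in Hr'.
  by have [<- _] := reads_term_inj Hr' Hr.
Qed.

Lemma intended_rules : sat_rules N intended rules.
Proof.
rewrite !sat_rules_cat; split; first exact: intended_syntax.
by split; apply: intended_closure.
Qed.

End Input.

(** * Completeness of the rules *)

Section Completeness.
Variables (S : signature) (G : bool -> seq (equation S)).
Let w := input G.
Let N := (size w).+1.
Variable D : predicate -> nat -> nat -> Prop.
Hypothesis D_rules : sat_rules N D rules.
Hypothesis D_first : D First 0 0.
Hypothesis D_bit : forall p b, bit_at w p b -> D (BitIs b) p p.
Hypothesis D_succ : forall p, p.+1 < N -> D Succ p p.+1.

(** The list gives the values of the variables in order; those beyond its end get the default 0, a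
    legal position. *)
Lemma fire r (s : seq nat) : sat_rule N D r -> all (ltn^~ N) s ->
  foldr (fun (a : atom predicate) (Q : Prop) =>
           D a.1.1 (nth 0 s a.1.2) (nth 0 s a.2) -> Q)
        (D r.1.1.1 (nth 0 s r.1.1.2) (nth 0 s r.1.2)) r.2.
Proof.
move=> Hr Hs; suff H : forall v : 'I_6, nth 0 s v < N.
  exact: (Hr (fun v => nth 0 s v) H).
move=> v; case: (ltnP v (size s)) => vs; last by rewrite nth_default.
by move/allP: Hs; apply; apply: mem_nth.
Qed.

Lemma D_syntax : sat_rules N D syntax_rules.
Proof. by move: D_rules; rewrite !sat_rules_cat => -[]. Qed.

Lemma D_closure b : sat_rules N D (closure_rules b).
Proof. by move: D_rules; rewrite !sat_rules_cat => -[_ []]; case: b. Qed.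

(** The bound on [q], here and below, makes the end a possible value of a variable. It holds for
    every term of the equations, as the closing bit of the list comes later. *)
Lemma D_SymEnd f p q : reads w p (enc_nat f) q -> q < N -> D SymEnd p q.
Proof.
have [R1 [R2 _]] := D_syntax.
elim: f p => [|f IH] p /= [pb H] qN.
  rewrite -H in qN *; apply: (fire (s := [:: p; p.+1]) R1) => /=.
  - by rewrite qN ltnW.
  - exact: D_bit.
  - exact: D_succ.
have := reads_size H => Eq.
apply: (fire (s := [:: p; q; p.+1]) R2) => /=; first lia.
- exact: D_bit.
- by apply: D_succ; lia.
- exact: IH.
Qed.

Lemma D_SameSym f p q p' q' : reads w p (enc_nat f) q ->
  reads w p' (enc_nat f) q' -> q < N -> q' < N -> D SameSym p p'.
Proof.
have [_ [_ [R1 [R2 _]]]] := D_syntax.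
elim: f p p' => [|f IH] p p' /= [pb H] [pb' H'] qN qN'.
  apply: (fire (s := [:: p; p']) R1) => /=; [lia|exact: D_bit..].
have := reads_size H => Eq; have := reads_size H' => Eq'.
apply: (fire (s := [:: p; p'; p.+1; p'.+1]) R2) => /=; first lia.
- exact: D_bit.
- exact: D_bit.
- by apply: D_succ; lia.
- by apply: D_succ; lia.
- exact: IH H H' qN qN'.
Qed.

Lemma D_ArgsEnd n (a : 'I_n -> term S) (xs : seq 'I_n) p q :
  (forall x p q, reads w p (enc_term (a x)) q -> q < N -> D TermEnd p q) ->
  reads w p (enc_seq (@enc_term S \o a) xs) q -> q < N -> D ArgsEnd p q.
Proof.
have [_ [_ [_ [_ [_ [R1 [R2 _]]]]]]] := D_syntax => Ha.
elim: xs p => [|x xs IH] p.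
  move=> [pb <-] qN; apply: (fire (s := [:: p; p.+1]) R1) => /=; first lia.
    exact: D_bit.
  exact: D_succ.
rewrite enc_seq_cons => -[pb /reads_cat[m Hm Hq]] qN.
have := reads_size Hm => Em; have := reads_size Hq => Eq.
apply: (fire (s := [:: p; q; p.+1; m]) R2) => /=; first lia.
- exact: D_bit.
- by apply: D_succ; lia.
- by apply: Ha Hm _; lia.
- exact: IH.
Qed.

Lemma D_TermEnd (t : term S) p q : reads w p (enc_term t) q -> q < N ->
  D TermEnd p q.
Proof.
have [_ [_ [_ [_ [R _]]]]] := D_syntax.
elim/term_induction: t p q => f a IH p q /reads_cat[m Hm Hq] qN.
have := reads_size Hm => Em; have := reads_size Hq => Eq.
apply: (fire (s := [:: p; q; m]) R) => /=; first lia.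
- by apply: D_SymEnd Hm _; lia.
- exact: D_ArgsEnd IH Hq qN.
Qed.

Section OneTheory.
Variable b : bool.

Lemma D_Equiv_sym p q : p < N -> q < N -> D (Equiv b) p q -> D (Equiv b) q p.
Proof.
have [_ [_ [R _]]] := D_closure b => pN qN.
by apply: (fire (s := [:: q; p]) R) => /=; lia.
Qed.

Lemma D_Equiv_trans p q r : p < N -> q < N -> r < N ->
  D (Equiv b) p q -> D (Equiv b) q r -> D (Equiv b) p r.
Proof.
have [_ [_ [_ [R _]]]] := D_closure b => pN qN rN.
by apply: (fire (s := [:: p; r; q]) R) => /=; lia.
Qed.

Lemma D_EquivArgs n (a c : 'I_n -> term S) (xs : seq 'I_n) p q p' q' :
  (forall x p q p' q', reads w p (enc_term (a x)) q ->
     reads w p' (enc_term (c x)) q' -> q < N -> q' < N -> D (Equiv b) p p') ->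
  reads w p (enc_seq (@enc_term S \o a) xs) q ->
  reads w p' (enc_seq (@enc_term S \o c) xs) q' -> q < N -> q' < N ->
  D (EquivArgs b) p p'.
Proof.
have [_ [_ [_ [_ [_ [R1 [R2 _]]]]]]] := D_closure b => Hac.
elim: xs p p' => [|x xs IH] p p'.
  move=> [pb Eq] [pb' Eq'] qN qN'.
  by apply: (fire (s := [:: p; p']) R1) => /=; [lia|exact: D_bit..].
rewrite !enc_seq_cons => -[pb /reads_cat[m Hm Hq]] [pb' /reads_cat[m' Hm' Hq']].
move=> qN qN'.
have := reads_size Hm => Em; have := reads_size Hq => Eq.
have := reads_size Hm' => Em'; have := reads_size Hq' => Eq'.
apply: (fire (s := [:: p; p'; p.+1; p'.+1; m; m']) R2) => /=; first lia.
- exact: D_bit.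
- exact: D_bit.
- by apply: D_succ; lia.
- by apply: D_succ; lia.
- by apply: Hac Hm Hm' _ _; lia.
- by apply: D_TermEnd Hm _; lia.
- by apply: D_TermEnd Hm' _; lia.
- exact: IH.
Qed.

Lemma D_Equiv_app f (a c : {ffun 'I_(arity f) -> term S}) p q p' q' :
  (forall x p q p' q', reads w p (enc_term (a x)) q ->
     reads w p' (enc_term (c x)) q' -> q < N -> q' < N -> D (Equiv b) p p') ->
  reads w p (enc_term (App a)) q -> reads w p' (enc_term (App c)) q' ->
  q < N -> q' < N -> D (Equiv b) p p'.
Proof.
have [_ [_ [_ [_ [R _]]]]] := D_closure b => Hac.
move=> /reads_cat[m Hm Hq] /reads_cat[m' Hm' Hq'] qN qN'.
have := reads_size Hm => Em; have := reads_size Hq => Eq.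
have := reads_size Hm' => Em'; have := reads_size Hq' => Eq'.
have mN : m < N by lia.
have mN' : m' < N by lia.
apply: (fire (s := [:: p; p'; m; m']) R) => /=; first lia.
- exact: D_SameSym Hm Hm' mN mN'.
- exact: D_SymEnd Hm mN.
- exact: D_SymEnd Hm' mN'.
- exact: D_EquivArgs Hac Hq Hq' qN qN'.
Qed.

Lemma D_Equiv_refl (t : term S) p q p' q' : reads w p (enc_term t) q ->
  reads w p' (enc_term t) q' -> q < N -> q' < N -> D (Equiv b) p p'.
Proof.
elim/term_induction: t p q p' q' => f a IH p q p' q'.
by apply: D_Equiv_app => x; apply: IH.
Qed.

Definition occurs (t : term S) : Prop :=
  exists p q, reads w p (enc_term t) q /\ q < N.

Definition equated (t u : term S) : Prop :=
  exists p q p' q', [/\ reads w p (enc_term t) q, reads w p' (enc_term u) q',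
    q < N, q' < N & D (Equiv b) p p'].

Lemma reads_start p s q : reads w p s q -> q < N -> p < N.
Proof. by move=> /reads_size ->; apply: leq_ltn_trans; rewrite leq_addr. Qed.

(** The fact known for one pair of occurrences passes to any other pair, because occurrences of the
    same term are equivalent. *)
Lemma equated_at t u p q p' q' : equated t u -> reads w p (enc_term t) q ->
  reads w p' (enc_term u) q' -> q < N -> q' < N -> D (Equiv b) p p'.
Proof.
move=> [r [m [r' [m' [Hr Hr' mN mN' rr']]]]] Hp Hp' qN qN'.
have pN := reads_start Hp qN; have pN' := reads_start Hp' qN'.
have rN := reads_start Hr mN; have rN' := reads_start Hr' mN'.
apply: (@D_Equiv_trans p r p') => //; first exact: D_Equiv_refl Hp Hr qN mN.
apply: (@D_Equiv_trans r r' p') => //; exact: D_Equiv_refl Hr' Hp' mN' qN'.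
Qed.

Lemma reads_arg n (a : 'I_n -> term S) (xs : seq 'I_n) x p q : x \in xs ->
  reads w p (enc_seq (@enc_term S \o a) xs) q ->
  exists m r, reads w m (enc_term (a x)) r /\ r <= q.
Proof.
elim: xs p => // y xs IH p; rewrite inE enc_seq_cons.
move=> /predU1P[->|xxs] [_ /reads_cat[m Hm Hq]]; last exact: IH Hq.
by exists p.+1, m; split=> //; rewrite (reads_size Hq) leq_addr.
Qed.

Lemma occurs_arg f (a : {ffun 'I_(arity f) -> term S}) i :
  occurs (App a) -> occurs (a i).
Proof.
move=> [p [q [/reads_cat[m _ Hq] qN]]].
have [//|r [r' [Hr le]]] := reads_arg (x := i) _ Hq; first exact: mem_enum.
by exists r, r'; split=> //; apply: leq_ltn_trans qN.
Qed.

(** [sim_closure] for the occurring terms, which are closed under subterms, with the derived facts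
    as the relation. *)
Lemma sim_equated t u : (forall e, e \in G b -> equated e.1 e.2) ->
  sim (G b) t u -> occurs t -> occurs u -> equated t u.
Proof.
move=> HG; apply: sim_closure.
- exact: occurs_arg.
- by move=> v [p [q [H qN]]]; exists p, q, p, q; split=> //;
  exact: (D_Equiv_refl H H qN qN).
- move=> v v' [p [q [p' [q' [H H' qN qN' pp']]]]].
  exists p', q', p, q; split=> //.
  exact: D_Equiv_sym (reads_start H qN) (reads_start H' qN') pp'.
- move=> x y z xy [p [q [p' [q' [H H' qN qN' pp']]]]].
  have := xy => -[r [m [_ [_ [Hr _ mN _ _]]]]].
  exists r, m, p', q'; split=> //.
  apply: D_Equiv_trans pp'; try exact: reads_start;
    [exact: reads_start Hr mN|exact: reads_start H qN|exact: reads_start H' qN'|].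
  exact: equated_at xy Hr H mN qN.
- move=> f a c [p [q [H qN]]] [p' [q' [H' qN']]] ac.
  exists p, q, p', q'; split=> //; apply: D_Equiv_app H H' qN qN'.
  by move=> x; move: (ac x) => E r m r' m'; apply: equated_at.
- move=> e /HG eq12; have := eq12 => -[p [q [p' [q' [H H' qN qN' _]]]]].
  by split=> //; [exists p, q|exists p', q'].
Qed.

End OneTheory.

Lemma remaining_le b p (suf : seq (equation S)) q : reads w p (enc_eqs suf) q ->
  (if b then q = N else reads w q (enc_eqs (G true)) N) -> q <= N.
Proof.
by case: b => [_ -> //|_ /reads_size E]; rewrite [leqRHS]E leq_addr.
Qed.

Lemma enc_eqs_cons (e : equation S) s : enc_eqs (e :: s) =
  true :: enc_term e.1 ++ enc_term e.2 ++ enc_eqs s.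
Proof. by rewrite /enc_eqs enc_seq_cons -catA. Qed.

(** The second part gives the position of the closing bit, from which the walk through the second
    list starts. *)
Lemma D_items b p suf q : D (Item b) p p -> reads w p (enc_eqs suf) q ->
  q <= N ->
  (forall e, e \in suf -> equated b e.1 e.2) /\
  exists p', [/\ q = p'.+1, bit_at w p' false & D (Item b) p' p'].
Proof.
have [R1 [R2 _]] := D_closure b.
elim: suf p => [|e suf IH] p Dp; first by move=> [pb <-]; split=> //; exists p.
rewrite enc_eqs_cons => -[p1 /reads_cat[m Hm /reads_cat[r Hr Hq]]] qN.
have := reads_size Hm => Em; have := reads_size Hr => Er.
have rq : r < q by rewrite (reads_size Hq) /enc_eqs /enc_seq size_rcons; lia.
have rN : r < N by lia.
have mN : m < N by lia.
have D1 := D_TermEnd Hm mN; have D2 := D_TermEnd Hr rN.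
have DS : D Succ p p.+1 by apply: D_succ; lia.
have Dr : D (Item b) r r.
  apply: (fire (s := [:: p; p.+1; m; r]) R1) => //=; first lia.
  exact: D_bit.
have Dpm : D (Equiv b) p.+1 m.
  apply: (fire (s := [:: p; p.+1; m]) R2) => //=; first lia.
  exact: D_bit.
have [Hsuf Hend] := IH r Dr Hq qN; split=> // x.
rewrite inE => /predU1P[->|]; last exact: Hsuf.
by exists p.+1, m, m, r; split.
Qed.

Lemma D_checked b p suf q : D (Checked b) p p -> reads w p (enc_eqs suf) q ->
  q <= N -> (forall e, e \in suf -> occurs e.1 -> occurs e.2 ->
    equated (~~ b) e.1 e.2) ->
  exists p', [/\ q = p'.+1, bit_at w p' false & D (Checked b) p' p'].
Proof.
have [_ [_ [_ [_ [_ [_ [_ [R _]]]]]]]] := D_closure b.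
elim: suf p => [|e suf IH] p Dp; first by move=> [pb <-]; exists p.
rewrite enc_eqs_cons => -[p1 /reads_cat[m Hm /reads_cat[r Hr Hq]]] qN Heq.
have := reads_size Hm => Em; have := reads_size Hr => Er.
have rq : r < q by rewrite (reads_size Hq) /enc_eqs /enc_seq size_rcons; lia.
have rN : r < N by lia.
have mN : m < N by lia.
apply: (IH r) => // [|x xsuf]; last by apply: Heq; rewrite inE xsuf orbT.
apply: (fire (s := [:: p; p.+1; m; r]) R) => //=; first lia.
- exact: D_bit.
- by apply: D_succ; lia.
- exact: D_TermEnd Hm mN.
- exact: D_TermEnd Hr rN.
- apply: (equated_at _ Hm Hr mN rN); apply: Heq; first exact: mem_head.
    by exists p.+1, m.
  by exists m, r.
Qed.

Lemma D_accept : derivable G true (G false) -> derivable G false (G true) ->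
  D Accept 0 0.
Proof.
move=> H1 H2.
have [_ [_ [_ [_ [_ [_ [_ [R1 [R2 [R3 [R4 [R5 _]]]]]]]]]]]] := D_syntax.
have [q Hq Hq'] := remaining_start G.
have qN : q <= N := remaining_le (b := false) Hq Hq'.
have N1 : 1 < N by have := reads_size Hq; rewrite /enc_eqs /enc_seq size_rcons; lia.
have D01 : D Succ 0 1 by apply: D_succ.
have I1 : D (Item false) 1 1.
  by apply: (fire (s := [:: 0; 1]) R1) => //=; lia.
have C1 : D (Checked false) 1 1.
  by apply: (fire (s := [:: 0; 1]) R3) => //=; lia.
have [E1 [p [Eq p0 Ip]]] := D_items I1 Hq qN.
have qN' : q < N.
  by have := reads_size Hq'; rewrite -/w -/N /enc_eqs /enc_seq size_rcons; lia.
have Dpq : D Succ p q by rewrite Eq; apply: D_succ; rewrite -Eq.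
have Iq : D (Item true) q q.
  apply: (fire (s := [:: p; q]) R2) => //=; first lia.
  exact: D_bit.
have [E2 _] := D_items Iq Hq' (leqnn N).
have eqs b e : e \in G b -> equated b e.1 e.2 by case: b; [apply: E2|apply: E1].
have [p' [Eq' p0' Cp]] := D_checked C1 Hq qN
  (fun e He => sim_equated (eqs true) (H1 e He)).
(* Both walks through the first list end just before [q], so [p'] is [p]. *)
have {p' Eq' p0' Cp} Cq : D (Checked true) q q.
  move: Eq' Cp; rewrite Eq => -[<-] Cp.
  apply: (fire (s := [:: p; p.+1]) R4) => //=; first lia.
    exact: D_bit.
  by rewrite -Eq.
have [r [Er r0 Cr]] := D_checked Cq Hq' (leqnn N)
  (fun e He => sim_equated (eqs false) (H2 e He)).
have rN : r < N by rewrite /N /w Er.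
apply: (fire (s := [:: 0; r]) R5) => //=; first lia.
exact: D_bit.
Qed.

End Completeness.

(** * The decision procedure *)

Section Isomorphism.
Variables (S : signature) (G : bool -> seq (equation S)).

Lemma sim_derivable b c p q : derivable G c (G b) -> sim (G b) p q ->
  sim (G c) p q.
Proof. by move=> H pq; apply: pq (sim_congruence _) _ => e /H. Qed.

Lemma class_repr b (c : quotient (G b)) : class (G b) (repr c) = c.
Proof. exact: reprK. Qed.

Lemma isomorphic_quotients :
  isomorphic (quotient (G false)) (quotient (G true)) <->
  derivable G true (G false) /\ derivable G false (G true).
Proof.
split=> [[h [bij_h hom_h]]|[H1 H2]].
  (* Constants are the case without arguments, so induction on terms leaves [h] no choice. *)
  have hE t : h (class (G false) t) = class (G true) t.
    elim/term_induction: t => f a IH.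
    rewrite [class _ _](@class_hom S (G false) f a) hom_h.
    rewrite [RHS](@class_hom S (G true) f a); congr op.
    by apply/ffunP => i; rewrite !ffunE.
  split=> e Ge.
    by apply/class_eq; rewrite -!hE; congr h; apply/class_eq => R _; apply.
  apply/class_eq/(bij_inj bij_h); rewrite !hE.
  by apply/class_eq => R _; apply.
pose h b c (x : quotient (G b)) : quotient (G c) := class (G c) (repr x).
have hE b c t : derivable G c (G b) -> h b c (class (G b) t) = class (G c) t.
  move=> Hbc; apply/class_eq; apply: (sim_derivable Hbc).
  by apply/class_eq; apply: class_repr.
have hK b c : derivable G c (G b) -> derivable G b (G c) ->
    cancel (h b c) (h c b).
  by move=> Hbc Hcb x; rewrite {2}/h hE // class_repr.
exists (h false true); split; first by exists (h true false); apply: hK.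
move=> f a; rewrite [op a in LHS]/(class _ _) hE //.
rewrite [LHS](@class_hom S (G true)); congr op.
by apply/ffunP => i; rewrite !ffunE.
Qed.

End Isomorphism.

(** * Length of the encoding *)

Section Size.
Variable S : signature.

Lemma size_enc_seq (T : Type) (enc : T -> seq bool) (xs : seq T) :
  size (enc_seq enc xs) = (\sum_(x <- xs) (size (enc x)).+1).+1.
Proof.
elim: xs => [|x xs IH]; first by rewrite big_nil.
by rewrite enc_seq_cons big_cons /= size_cat IH addSn addnS.
Qed.

Lemma size_enc_nat n : size (enc_nat n) = n.+1.
Proof. by rewrite size_rcons size_nseq. Qed.

(** A node accounts for at most [nsym S] bits for its symbol, the bit closing its arguments, and the
    bit by which its parent announces it. The successor on the left is this last bit for the
    root. *)
Lemma size_enc_term (t : term S) :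
  (size (enc_term t)).+1 <= term_size t * (nsym S).+2.
Proof.
elim/term_induction: t => f a IH /=.
rewrite size_cat size_enc_nat size_enc_seq big_enum mulSn big_distrl /=.
set s := (\sum_(i in _) _)%N; set s' := (\sum_(i < _) _)%N.
suff : s <= s' by have := ltn_ord f; lia.
by apply: leq_sum => i _; apply: IH.
Qed.

Lemma size_enc_eqs (s : seq (equation S)) :
  size (enc_eqs s) <= (eqs_size s * (nsym S).+2).+1.
Proof.
rewrite size_enc_seq ltnS /eqs_size big_distrl /=.
apply: leq_sum => e _; rewrite size_cat mulnDl.
by have := size_enc_term e.1; have := size_enc_term e.2; lia.
Qed.

Lemma enc_eqs_gt0 (s : seq (equation S)) : 0 < size (enc_eqs s).
Proof. by rewrite size_enc_seq. Qed.

End Size.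

(** The outermost variable stands for the number of symbols. The summand 4 collects one for each
    list in [size_enc_eqs], one from [N = (size w).+1], and one from the base [n.+1] in
    [poly_bounded]. *)
Definition bound_poly (C d : nat) : {poly {poly {poly nat}}} :=
  (C%:P%:P%:P *
   (('X%:P + 'X%:P%:P) * ('X + 2%N%:P%:P%:P) + 4%N%:P%:P%:P) ^+ d)%R.

Lemma bound_polyE C d x y z :
  poly3_eval (bound_poly C d) x y z = C * ((y + z) * (x + 2) + 4) ^ d.
Proof.
rewrite /poly3_eval /bound_poly !(hornerE, horner_exp).
have natX (m : nat) : (m ^+ d)%R = m ^ d.
  by elim: d => // d IH; rewrite GRing.exprS IH -expnS.
by rewrite natX.
Qed.

Definition decide := main_prog rules First Succ BitIs.

Definition decider : machine :=
  deciding_machine decide (fun h => cell_has Accept (h tableT)).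

Lemma final_table_accept (S : signature) (G : bool -> seq (equation S)) :
  Accept \in final_table rules First Succ BitIs (input G) 0 <->
  derivable G true (G false) /\ derivable G false (G true).
Proof.
set w := input G; pose N := (size w).+1.
set tb0 := input_facts First Succ BitIs w.
(* Each of the two lists has at least its closing bit, so [N] is at least 3 and [3 ^ 4 = 81] exceeds
   the 24 codes of predicates. *)
have w_gt1 : 1 < size w.
  rewrite size_cat; have := enc_eqs_gt0 (G false).
  by have := enc_eqs_gt0 (G true); rewrite -!/(enc_eqs _); lia.
have big : #|{: predicate}| < N ^ 4.
  apply: leq_ltn_trans card_predicate _.
  by apply: (@leq_trans (3 ^ 4)) => //; rewrite leq_exp2r.
have markE i : i < N -> mark First BitIs (nth None (word predicate w) i) =
    if i is j.+1 then BitIs (nth false w j) else First.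
  case: i => // i; rewrite ltnS => iN.
  by rewrite /= nth_rcons size_map iN (nth_map false).
have [Hmark Hsucc] := input_facts_mem First Succ BitIs w.
have le0 p i j : fact N tb0 p i j ->
    fact N (final_table rules First Succ BitIs w) p i j.
  exact/subsetP/saturate_inflationary.
split=> [acc|[H1 H2]].
  have := @saturate_least _ rules N (fun=> 0) tb0 (intended G).
  move=> /(_ (fun=> isT) (intended_rules G)) H.
  suff /H /(_ Accept 0 0 isT isT acc) : facts_in N tb0 (intended G) by [].
  apply: input_facts_in => // i iN.
  rewrite markE //; case: i iN => // i iN; split=> //=.
have := @D_accept S G (fact N (final_table rules First Succ BitIs w)).
apply=> //.
- exact: saturate_sat.
- by apply: le0; have := Hmark 0 isT.
- move=> p b [/andP[p0 pw] <-]; apply: le0.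
  by have := Hmark p pw; rewrite markE //; case: p p0 {pw}.
- by move=> p pN; apply/le0/Hsucc.
Qed.

Lemma answers_within_le (M : machine) x m n b :
  answers_within M x m b -> m <= n -> answers_within M x n b.
Proof.
rewrite /answers_within => H /subnK <-.
elim: (n - m) => // k IH; rewrite addSn /=.
by have -> : step (iter (k + m) (@step M) (init M x)) =
  iter (k + m) (@step M) (init M x) by rewrite {1}/step IH.
Qed.

Theorem corollary3p14 :
  exists (M : machine) (P : {poly {poly {poly nat}}}),
    forall (S : signature) (G1 G2 : seq (equation S)),
      exists b : bool,
        answers_within M (enc_instance G1 G2)
          (poly3_eval P (nsym S) (eqs_size G1) (eqs_size G2)) b
        /\ (b = true <-> isomorphic (quotient G1) (quotient G2)).
Proof.
have [cost [C [d Hcost]] Hmain] := exec_main rules First Succ Accept BitIs.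
exists decider, (bound_poly C d) => S G1 G2.
pose G b := if b then G2 else G1.
exists (Accept \in final_table rules First Succ BitIs (input G) 0); split.
  rewrite /enc_instance catA.
  apply: answers_within_le (Hmain S G1 G2 (enc_signature S)) _.
  rewrite bound_polyE; apply: leq_trans (Hcost _) _; rewrite leq_mul2l.
  case: (posnP d) => [->|d0]; rewrite ?expn0 ?leqnn ?orbT // leq_exp2r //.
  apply/orP; right.
  rewrite size_cat; have := size_enc_eqs G1; have := size_enc_eqs G2.
  rewrite mulnDl addn2 -!/(enc_eqs _); lia.
by rewrite (isomorphic_quotients G); apply: final_table_accept.
Qed.
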